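(* Let $N$ be an $n$-dimensional Riemannian manifold, let $f\colon\mathbb{R}\to\mathbb{R}_{>0}$ be a smooth logarithmically convex function with $f(0)=1$ that is unbounded on $[0,\infty)$, and let $W=\mathbb{R}\times_f N$ be the associated $(1+n)$-dimensional warped product, assumed complete. Let $F\subseteq\{0\}\times N$ be a piecewise smooth $n$-dimensional floor of finite positive $n$-volume. Then for all sufficiently large $A$ (depending on $F$ and $f$) the equation $$\mathrm{Vol}_n(S(h))=\mathrm{Vol}_n(F)\,f(h)^n=A$$ has either one or two solutions $h\in[0,\infty)$, and, taking $h$ to be the solution for which $\mathrm{Vol}_{1+n}(B(h))$ is largest, the room $B(h)$ has the maximal $(1+n)$-volume among all rooms with floor $F$ whose ceiling is the graph over $F$ of an almost everywhere differentiable function $g\colon\eta(F)\to[0,\infty)$ and has $n$-volume $A$.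
   Context: Warped product: given a smooth function $f\colon\mathbb{R}\to\mathbb{R}_{>0}$ and a Riemannian manifold $N$, let $\pi\colon\mathbb{R}\times N\to\mathbb{R}$ and $\eta\colon\mathbb{R}\times N\to N$ be the projections. The warped product $W=\mathbb{R}\times_f N$ is the product manifold $\mathbb{R}\times N$ with the Riemannian metric satisfying $\|v\|_W^2=\|\pi_*(v)\|_{\mathbb{R}}^2+f(\pi(p))^2\|\eta_*(v)\|_N^2$ for all $v\in T_pW$. The function $f$ is logarithmically convex if $\log f$ is convex (not necessarily strictly). Graphs and rooms: for $F\subseteq\{0\}\times N$ (the floor) and $g\colon\eta(F)\to[0,\infty)$ (possibly discontinuous, differentiable almost everywhere), the graph of $g$ over $F$ (the ceiling) is $C=\{(g(q),q):(0,q)\in F\}\subset W$, and the room over $F$ enclosed by $C$ is $R=\{(t,q):(0,q)\in F,\ 0\le t\le g(q)\}\subset W$. For $h\ge 0$, $S(h)=\{(h,q):(0,q)\in F\}$ denotes the constant height $h$ graph over $F$ and $B(h)=\{(t,q):(0,q)\in F,\ 0\le t\le h\}$ its associated room. $\mathrm{Vol}_k(\cdot)$ denotes $k$-dimensional volume with respect to the metric of $W$. *)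

(* Defs.v *)
From HB Require Import structures.
From mathcomp Require Import all_boot all_order all_algebra.
From mathcomp Require Import all_classical all_reals all_analysis.

Set Implicit Arguments.
Unset Strict Implicit.
Unset Printing Implicit Defensive.

Import Order.TTheory GRing.Theory Num.Theory numFieldNormedType.Exports.

Local Open Scope classical_set_scope.
Local Open Scope ring_scope.

Definition tcons (R : realType) (n : nat)
    (p : measurableTypeR R * n.-tuple (measurableTypeR R)) :
    n.+1.-tuple (measurableTypeR R) :=
  [the n.+1.-tuple (measurableTypeR R) of p.1 :: p.2].

Lemma measurable_tcons (R : realType) (n : nat) :
  measurable_fun setT (@tcons R n).
Proof. exact: measurable_cons. Qed.

HB.instance Definition _ (R : realType) (n : nat) :=
  isMeasurableFun.Build _ _ _ _ (@tcons R n) (@measurable_tcons R n).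

Section lebesgue_succ.
Context (R : realType) (n : nat).
Variable mu : {sigma_finite_measure set (n.-tuple (measurableTypeR R)) -> \bar R}.

Definition lebesgue_succ : set (n.+1.-tuple (measurableTypeR R)) -> \bar R :=
  pushforward (@lebesgue_measure R \x mu)%E (@tcons R n).

Let lebesgue_succ0 : lebesgue_succ set0 = 0%E.
Proof. exact: measure0. Qed.

Let lebesgue_succ_ge0 A : (0 <= lebesgue_succ A)%E.
Proof. exact: measure_ge0. Qed.

Let lebesgue_succ_sigma_additive : semi_sigma_additive lebesgue_succ.
Proof. exact: (@measure_semi_sigma_additive _ _ _
  (pushforward (@lebesgue_measure R \x mu)%E (@tcons R n))). Qed.

HB.instance Definition _ := isMeasure.Build _ _ _ lebesgue_succ
  lebesgue_succ0 lebesgue_succ_ge0 lebesgue_succ_sigma_additive.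

Let lebesgue_succ_sigma_finite : sigma_finite setT lebesgue_succ.
Proof.
have /sigma_finiteP[F [FT Fnd Ffin]] := sigma_finiteT (@lebesgue_measure R).
have /sigma_finiteP[G [GT Gnd Gfin]] := sigma_finiteT mu.
pose u (x : n.+1.-tuple (measurableTypeR R)) := (thead x, [tuple of behead x]).
have uK : cancel (@tcons R n) u by move=> [a t]; congr pair; apply/val_inj.
have mu_ : measurable_fun setT u.
  apply/measurable_fun_pairP; split.
    by have := @measurable_tnth _ (measurableTypeR R) n.+1 ord0.
  exact: measurable_behead.
exists (fun k => u @^-1` (F k `*` G k)).
  rewrite -preimage_bigcup; apply/esym/seteqP; split => // x _.
  have [i _ Fi] : (\bigcup_i F i) (u x).1 by rewrite -FT.
  have [j _ Gj] : (\bigcup_i G i) (u x).2 by rewrite -GT.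
  exists (maxn i j) => //; split.
    by move: Fi; apply/subsetPset/Fnd/leq_maxl.
  by move: Gj; apply/subsetPset/Gnd/leq_maxr.
move=> k; have [mF Foo] := Ffin k; have [mG Goo] := Gfin k; split.
  by rewrite -[X in measurable X]setTI; apply: mu_ => //; exact: measurableX.
rewrite /lebesgue_succ /pushforward -comp_preimage.
rewrite (_ : u \o _ = id); last by apply/funext => p /=; rewrite uK.
by rewrite preimage_id product_measure1E// lte_mul_pinfty// ge0_fin_numE.
Qed.

HB.instance Definition _ := Measure_isSigmaFinite.Build _ _ _ lebesgue_succ
  lebesgue_succ_sigma_finite.

End lebesgue_succ.

Fixpoint lebesgue_tuple (R : realType) (n : nat) :
    {sigma_finite_measure set (n.-tuple (measurableTypeR R)) -> \bar R} :=
  if n is n'.+1 then lebesgue_succ (lebesgue_tuple R n')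
  else \d_([tuple] : 0.-tuple (measurableTypeR R)).

Definition row_of_tuple (R : realType) (n : nat)
    (t : n.-tuple (measurableTypeR R)) : 'rV[R]_n :=
  \row_i tnth t i.

(* The measure lives on the Borel sets, and [\int[mu]_(x in D) f x] is defined,
   for an arbitrary nonnegative [f \_ D], as a supremum over the Borel simple
   functions below it. It is therefore the usual Lebesgue integral as soon as
   [f \_ D] is measurable for the completed (Lebesgue) sigma-algebra. *)
Definition rV_integral (R : realType) (n : nat) (D : set 'rV[R]_n)
    (rho : 'rV[R]_n -> R) : \bar R :=
  (\int[lebesgue_tuple R n]_(t in @row_of_tuple R n @^-1` D)
     (rho (row_of_tuple t))%:E)%E.

Definition rV_negligible (R : realType) (n : nat) (D : set 'rV[R]_n) : Prop :=
  (lebesgue_tuple R n).-negligible (@row_of_tuple R n @^-1` D).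

(* To be used with [U] open. *)
Fixpoint Ck_on (R : realType) (V W : normedModType R) (k : nat) (U : set V)
    (f : V -> W) : Prop :=
  if k is k'.+1 then
    (forall x, U x -> differentiable f x) /\
    (forall v, Ck_on k' U (fun x => 'D_v f x))
  else forall x, U x -> {for x, continuous f}.

Definition smooth_on (R : realType) (V W : normedModType R) (U : set V)
    (f : V -> W) : Prop :=
  forall k, Ck_on k U f.

(* A countable atlas on [T] together with the matrices of the metric in its
   charts: [param i] is the inverse of the chart [coord i], defined on
   [chart_dom i] (possibly empty), and [metric i x] is the Gram matrix
   (g(d/dx_a, d/dx_b)) at the point of coordinates [x]. Only the values on the
   chart domains and on their images are meaningful. *)
Record metric_atlas (R : realType) (T : Type) (n : nat) := MetricAtlas {
  chart_dom : nat -> set T;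
  coord : nat -> T -> 'rV[R]_n;
  param : nat -> 'rV[R]_n -> T;
  metric : nat -> 'rV[R]_n -> 'M[R]_n
}.

Definition chart_img (R : realType) (T : Type) (n : nat)
    (M : metric_atlas R T n) (i : nat) (E : set T) : set 'rV[R]_n :=
  coord M i @` (E `&` chart_dom M i).

(* 'J f x acts on row vectors from the right, so that the change of coordinates
   of the metric is G_i = J G_j J^T. *)
Definition is_riemannian_manifold (R : realType) (T : topologicalType) (n : nat)
    (M : metric_atlas R T n) : Prop :=
  hausdorff_space T /\
  (forall p, exists i, chart_dom M i p) /\
  (forall i, [/\ open (chart_dom M i),
     open (chart_img M i setT),
     {in chart_dom M i, cancel (coord M i) (param M i)},
     (forall p, chart_dom M i p -> {for p, continuous (coord M i)}) &
     (forall x, chart_img M i setT x -> {for x, continuous (param M i)})]) /\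
  (forall i j, smooth_on (chart_img M i (chart_dom M j))
     (coord M j \o param M i)) /\
  (forall i, smooth_on (chart_img M i setT) (metric M i)) /\
  (forall i x, chart_img M i setT x ->
     (metric M i x)^T = metric M i x /\
     forall v : 'rV[R]_n, v != 0 -> 0 < (v *m metric M i x *m v^T) 0 0) /\
  (forall i j x, chart_img M i (chart_dom M j) x ->
     let tau := coord M j \o param M i in
     metric M i x = 'J tau x *m metric M j (tau x) *m ('J tau x)^T).

(* The disjoint pieces U_i \ (U_0 u ... u U_(i-1)), and the index of the piece
   containing [p]. *)
Definition chart_piece (R : realType) (T : Type) (n : nat)
    (M : metric_atlas R T n) (i : nat) : set T :=
  seqDU (chart_dom M) i.

Definition chart_at (R : realType) (T : Type) (n : nat)
    (M : metric_atlas R T n) (p : T) : nat :=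
  xget 0%N [set i | chart_piece M i p].

Definition riemannian_volume (R : realType) (T : Type) (n : nat)
    (M : metric_atlas R T n) (E : set T) : \bar R :=
  (\sum_(i <oo) rV_integral (chart_img M i (E `&` chart_piece M i))
     (fun x => Num.sqrt (\det (metric M i x))))%E.

Definition null_set (R : realType) (T : Type) (n : nat)
    (M : metric_atlas R T n) (E : set T) : Prop :=
  forall i, rV_negligible (chart_img M i E).

(* The matrix (g(d_a phi, d_b phi))_(a, b); it does not depend on the choice of
   the chart around [phi x]. *)
Definition pullback_metric (R : realType) (m : nat) (T : Type) (n : nat)
    (M : metric_atlas R T n) (phi : 'rV[R]_m -> T) (x : 'rV[R]_m) : 'M[R]_m :=
  let j := chart_at M (phi x) in
  let J := 'J (coord M j \o phi) x in
  J *m metric M j (coord M j (phi x)) *m J^T.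

(* The volume, of the dimension m of [N], of the image of [E] under a map
   Phi : N -> M which is injective, and differentiable almost everywhere,
   on E. *)
Definition parametrized_volume (R : realType) (S T : Type) (m n : nat)
    (N : metric_atlas R S m) (M : metric_atlas R T n) (Phi : S -> T)
    (E : set S) : \bar R :=
  (\sum_(i <oo) rV_integral (chart_img N i (E `&` chart_piece N i))
     (fun x => Num.sqrt (\det (pullback_metric M (Phi \o param N i) x))))%E.

(* Parametrized by [0, 1]; C^1 on a neighbourhood of [0, 1]. *)
Definition C1_curve (R : realType) (T : topologicalType) (n : nat)
    (M : metric_atlas R T n) (c : R -> T) : Prop :=
  forall s : R, 0 <= s <= 1 -> {for s, continuous c} /\
    forall i, chart_dom M i (c s) ->
      (\forall u \near s, derivable (coord M i \o c) u 1) /\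
      {for s, continuous (derive1 (coord M i \o c))}.

Definition speed (R : realType) (T : Type) (n : nat)
    (M : metric_atlas R T n) (c : R -> T) (s : R) : R :=
  let i := chart_at M (c s) in
  let v := derive1 (coord M i \o c) s in
  Num.sqrt ((v *m metric M i (coord M i (c s)) *m v^T) 0 0).

Definition curve_length (R : realType) (T : Type) (n : nat)
    (M : metric_atlas R T n) (c : R -> T) : \bar R :=
  (\int[lebesgue_measure]_(s in `[0%R, 1%R]) (speed M c s)%:E)%E.

(* [cs] is the list of the C^1 pieces of a piecewise C^1 curve from p to q. *)
Fixpoint joins (R : realType) (T : topologicalType) (n : nat)
    (M : metric_atlas R T n) (cs : seq (R -> T)) (p q : T) : Prop :=
  if cs is c :: cs' then [/\ C1_curve M c, c 0 = p & joins M cs' (c 1) q]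
  else p = q.

Definition riemannian_distance (R : realType) (T : topologicalType) (n : nat)
    (M : metric_atlas R T n) (p q : T) : \bar R :=
  ereal_inf [set (\sum_(c <- cs) curve_length M c)%E
            | cs in [set cs | joins M cs p q]].

Definition is_complete (R : realType) (T : topologicalType) (n : nat)
    (M : metric_atlas R T n) : Prop :=
  forall u : nat -> T,
    (forall e : R, 0 < e -> exists k, forall i j, (k <= i)%N -> (k <= j)%N ->
       (riemannian_distance M (u i) (u j) < e%:E)%E) ->
    exists l, forall e : R, 0 < e -> exists k, forall i, (k <= i)%N ->
       (riemannian_distance M (u i) l < e%:E)%E.

(* The charts are the products of the identity of R with those of N; the metric
   is dt^2 + f(t)^2 g_N, see [warped_product_sqnorm]. *)
Definition warped_product (R : realType) (T : Type) (n : nat) (f : R -> R)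
    (N : metric_atlas R T n) : metric_atlas R (R * T)%type (1 + n) := {|
  chart_dom i := [set p | chart_dom N i p.2];
  coord i p := row_mx p.1%:M (coord N i p.2);
  param i x := (lsubmx x 0 0, param N i (rsubmx x));
  metric i x := block_mx 1%:M 0 0
                  (f (lsubmx x 0 0) ^+ 2 *: metric N i (rsubmx x))
|}.

Lemma warped_product_sqnorm (R : realType) (T : Type) (n : nat) (f : R -> R)
    (N : metric_atlas R T n) (i : nat) (p : R * T) (a : R) (w : 'rV[R]_n) :
  let W := warped_product f N in
  let v : 'rV[R]_(1 + n) := row_mx a%:M w in
  (v *m metric W i (coord W i p) *m v^T) 0 0 =
  a ^+ 2 + f p.1 ^+ 2 * (w *m metric N i (coord N i p.2) *m w^T) 0 0.
Proof.
rewrite /= row_mxKl row_mxKr mul_row_block !mulmx0 mulmx1 addr0 add0r.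
rewrite tr_row_mx mul_row_col [LHS]mxE; congr (_ + _).
  by rewrite tr_scalar_mx -scalar_mxM !mxE eqxx expr2.
by rewrite -scalemxAr -scalemxAl !mxE eqxx mulr1n.
Qed.

(* Floors are given by their projection to N: [F : set T] stands for {0} x F. *)

Definition unit_cube (R : realType) (m : nat) : set 'rV[R]_m :=
  [set x | forall k, 0 <= x 0 k <= 1].

(* A smooth image in N of a cube of dimension n - 1, seen in one chart. *)
Definition smooth_cell (R : realType) (T : Type) (n : nat)
    (N : metric_atlas R T n) (K : set T) : Prop :=
  exists (i : nat) (s : 'rV[R]_n.-1 -> 'rV[R]_n),
    [/\ smooth_on setT s,
        s @` @unit_cube R n.-1 `<=` chart_img N i setT &
        K = param N i @` (s @` @unit_cube R n.-1)].

(* F is contained in the closure of its interior, and its frontier is a locally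
   finite union of smooth cells of dimension n - 1. *)
Definition piecewise_smooth_floor (R : realType) (T : topologicalType)
    (n : nat) (N : metric_atlas R T n) (F : set T) : Prop :=
  let frontier := closure F `\` interior F in
  F `<=` closure (interior F) /\
  forall p, frontier p -> exists (V : set T) (k : nat) (K : 'I_k -> set T),
    [/\ nbhs p V, forall j, smooth_cell N (K j),
        V `&` frontier `<=` \bigcup_j K j & \bigcup_j K j `<=` frontier].

(* Functions on F are given by arbitrary extensions to N. Frontier points of F,
   where differentiability would depend on the extension, are put in the
   exceptional null set. *)
Definition ae_differentiable (R : realType) (T : topologicalType) (n : nat)
    (N : metric_atlas R T n) (F : set T) (g : T -> R) : Prop :=
  null_set N [set q | F q /\ ~ (interior F q /\
    forall i, chart_dom N i q -> differentiable (g \o param N i) (coord N i q))].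

Definition graph_volume (R : realType) (T : Type) (n : nat) (f : R -> R)
    (N : metric_atlas R T n) (F : set T) (g : T -> R) : \bar R :=
  parametrized_volume N (warped_product f N) (fun q => (g q, q)) F.

Definition room (R : realType) (T : Type) (F : set T) (g : T -> R) :
    set (R * T)%type :=
  [set p | F p.2 /\ 0 <= p.1 <= g p.2].

Definition room_volume (R : realType) (T : Type) (n : nat) (f : R -> R)
    (N : metric_atlas R T n) (F : set T) (g : T -> R) : \bar R :=
  riemannian_volume (warped_product f N) (room F g).

(* The almost everywhere differentiable g : F -> [0, +oo[ whose graph has
   n-volume A. *)
Definition ceiling (R : realType) (T : topologicalType) (n : nat)
    (f : R -> R) (N : metric_atlas R T n) (F : set T) (A : R) :
    set (T -> R) :=
  [set g | [/\ forall q, F q -> 0 <= g q, ae_differentiable N F g &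
     graph_volume f N F g = A%:E]].

(* Main.v *)
Require Import Defs.
From mathcomp Require Import all_boot all_order all_algebra.
From mathcomp Require Import all_classical all_reals all_analysis.
From mathcomp Require Import measurable_realfun ring lra.
Import Order.TTheory GRing.Theory Num.Theory numFieldNormedType.Exports.
Local Open Scope classical_set_scope.
Local Open Scope ring_scope.

Set Implicit Arguments.
Unset Strict Implicit.
Unset Printing Implicit Defensive.

Local Notation coord := Defs.coord.
Local Notation null_set := Defs.null_set.

(* Write Phi(t) for the integral of f^n over [0, t].  A room under g has volume
   \int_F Phi(g), and its ceiling has n-volume at least \int_F f(g)^n, because
   the metric of a graph is f(g)^2 g_N plus the square of a linear form.  As log f
   is convex, f'/f is nondecreasing, so that for every h > 0 with f(h) > 1 the
   function c f^n - Phi, with c = f(h) / (n f'(h)) > 0, is minimal at h on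
   [0, +oo[.  Integrating this inequality at g over F gives
   \int_F Phi(g) <= Phi(h) |F| as soon as \int_F f(g)^n <= f(h)^n |F|.
   For A > |F| = f(0)^n |F|, convexity of log f leaves a single height h with
   f(h)^n |F| = A. *)

(** * Lower integrals *)

(** The constant [c] is a Lagrange multiplier: raising a column of height [t] adds volume at rate
    [f t ^+ n] and area of the horizontal slice at the rate of the derivative of [f ^+ n]; at [h]
    the ratio of the two rates is [c].

    The obstacle is measurability, which is never established for the floor or the ceiling. A lower
    integral is superadditive, but subadditivity asks for a measurable summand. Hence the form [P
    (g) + c * f h ^+ n <= P h + c * f (g) ^+ n], free of differences: the left side splits by
    superadditivity, and the right side splits because [P h] times the volume density is continuous.
    For the same reason Fubini is used one way at a time, as an upper bound for an arbitrary room
    and as a lower bound for a room of constant height.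

    That the height [h] is an admissible ceiling is not free either: points of the floor outside its
    interior count as exceptional, so the frontier must be shown null, by covering its cells of
    dimension [n - 1] with small cubes. *)

(* The library integral of a nonnegative function is the supremum of the
   integrals of the simple functions below it, measurable or not. Keeping only
   the linearity that survives without measurability spares any discussion of
   the measurability of the floor and of the ceiling. *)
Section lower_integral.
Local Open Scope ereal_scope.
Context d (T : measurableType d) (R : realType) (mu : {measure set T -> \bar R}).

(** Points where [f1] vanishes cost nothing, so [D1] may exceed [D2] there; this lets a function on
    the whole space be compared with an integrand on [D]. *)
Lemma le_lower_integral (D1 D2 : set T) (f1 f2 : T -> \bar R) :
  (forall x, D1 x -> 0 <= f1 x) -> (forall x, D2 x -> 0 <= f2 x) ->
  (forall x, D1 x -> 0 < f1 x -> D2 x /\ f1 x <= f2 x) ->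
  \int[mu]_(x in D1) f1 x <= \int[mu]_(x in D2) f2 x.
Proof.
move=> f10 f20 f12; rewrite !ge0_integralE//; apply: le_ereal_sup.
move=> _ [h hf <-]; exists h => // x; apply: le_trans (hf x) _.
rewrite !patchE; case: ifPn => [|_]; last first.
  by case: ifPn => //; rewrite inE; exact: f20.
rewrite inE => D1x; have := f10 x D1x; rewrite le_eqVlt => /predU1P[<-|f1x].
  by case: ifPn => //; rewrite inE; exact: f20.
by have [D2x f12x] := f12 x D1x f1x; rewrite mem_set.
Qed.

Import HBNNSimple.

(** [E] is the set where a simple function below [f] is positive: it is measurable even if [D] is
    not, so the measurable theory applies to [s]. *)
Lemma lower_integral_le (D : set T) (f : T -> \bar R) (a : \bar R) :
  (forall x, D x -> 0 <= f x) ->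
  (forall (E : set T) (s : T -> R), measurable E -> E `<=` D ->
     measurable_fun setT s -> (forall x, (0 <= s x)%R) ->
     (forall x, ~ E x -> s x = 0%R) -> (forall x, E x -> (s x)%:E <= f x) ->
     \int[mu]_x (s x)%:E <= a) ->
  \int[mu]_(x in D) f x <= a.
Proof.
move=> f0 H; rewrite ge0_integralE//; apply: ge_ereal_sup => _ [s sf <-].
rewrite -integralT_nnsfun.
have s0 x : (0 <= s x)%R by exact: fun_ge0.
apply: (H (s @^-1` `]0%R, +oo[%classic)).
- by rewrite -[X in measurable X]setTI; exact: (measurable_funPT s).
- move=> x /=; rewrite in_itv/= andbT => sx; have := sf x.
  rewrite patchE; case: ifPn => [|_]; first by rewrite inE.
  by rewrite lee_fin leNgt sx.
- exact: measurable_funPT.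
- exact: s0.
- move=> x /=; rewrite in_itv/= andbT => /negP; rewrite -leNgt => sx.
  by apply/eqP; rewrite eq_le sx s0.
- move=> x /=; rewrite in_itv/= andbT => sx; have := sf x.
  rewrite patchE; case: ifPn => //.
  by rewrite lee_fin leNgt sx.
Qed.

(** One inequality suffices: the reverse one is the same bound for the factor [k^-1]. *)
Lemma lower_integralZl (D : set T) (f : T -> R) (k : R) : (0 <= k)%R ->
  (forall x, D x -> (0 <= f x)%R) ->
  \int[mu]_(x in D) (k * f x)%:E = k%:E * \int[mu]_(x in D) (f x)%:E.
Proof.
have leZ (g : T -> R) (c : R) : (0 < c)%R -> (forall x, D x -> (0 <= g x)%R) ->
    \int[mu]_(x in D) (c * g x)%:E <= c%:E * \int[mu]_(x in D) (g x)%:E.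
  move=> c0 g0; apply: lower_integral_le => [x Dx|E s mE ED ms s0 sE sg].
    by rewrite lee_fin mulr_ge0 ?g0// ltW.
  rewrite -lee_pdivrMl// -ge0_integralZl_EFin//; last 3 first.
  - by move=> x _; rewrite lee_fin.
  - exact/measurable_EFinP.
  - by rewrite invr_ge0 ltW.
  apply: le_lower_integral => // x.
  - by move=> _; rewrite mule_ge0// lee_fin// invr_ge0 ltW.
  have [Ex _ _|Ex] := pselect (E x); last by rewrite sE// mule0 ltxx.
  split; first exact: ED.
  by have := sg x Ex; rewrite -EFinM !lee_fin ler_pdivrMl.
rewrite le_eqVlt => /predU1P[<- _|k0 f0].
  by rewrite mul0e integral0_eq// => x _; rewrite mul0r.
apply/eqP; rewrite eq_le leZ//= -lee_pdivlMl//.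
have := leZ (fun x => k * f x)%R k^-1%R.
rewrite invr_gt0 => /(_ k0); under eq_integral do rewrite mulKf ?gt_eqF//.
by apply => x Dx; rewrite mulr_ge0 ?f0// ltW.
Qed.

Lemma lower_integral_superadditive (D : set T) (f g : T -> R) :
  (forall x, D x -> (0 <= f x)%R) -> (forall x, D x -> (0 <= g x)%R) ->
  \int[mu]_(x in D) (f x)%:E + \int[mu]_(x in D) (g x)%:E <=
  \int[mu]_(x in D) (f x + g x)%:E.
Proof.
move=> f0 g0; set X := \int[mu]_(x in D) (f x + g x)%:E.
have gX : \int[mu]_(x in D) (g x)%:E <= X.
  apply: le_lower_integral => x Dx; first by rewrite lee_fin g0.
    by rewrite lee_fin addr_ge0 ?f0 ?g0.
  by move=> _; split => //; rewrite lee_fin lerDr f0.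
have G0 : 0 <= \int[mu]_(x in D) (g x)%:E.
  by apply: integral_ge0 => x Dx; rewrite lee_fin g0.
have [->|Xoo] := eqVneq X +oo; first by rewrite leey.
have Xfin : X \is a fin_num.
  by rewrite ge0_fin_numE ?(le_trans G0)// lt_neqAle Xoo leey.
have Gfin : \int[mu]_(x in D) (g x)%:E \is a fin_num.
  by rewrite ge0_fin_numE// (le_lt_trans gX)// ltey_eq Xfin.
(* With everything finite, terms can change sides, and the two suprema are bounded one after the
   other: first [s] below [f], then [s'] below [g]. *)
rewrite -leeBrDr//; apply: lower_integral_le => [x Dx|E s mE ED ms s0 sE sf].
  by rewrite lee_fin f0.
have sX : \int[mu]_x (s x)%:E <= X.
  apply: le_lower_integral => x; first by move=> _; rewrite lee_fin.
    by move=> Dx; rewrite lee_fin addr_ge0 ?f0 ?g0.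
  have [Ex _ _|Ex] := pselect (E x); last by rewrite sE// ltxx.
  split; first exact: ED.
  by rewrite (le_trans (sf x Ex))// lee_fin lerDl g0//; exact: ED.
have S0 : 0 <= \int[mu]_x (s x)%:E.
  by apply: integral_ge0 => x Dx; rewrite lee_fin.
have Sfin : \int[mu]_x (s x)%:E \is a fin_num.
  by rewrite ge0_fin_numE// (le_lt_trans sX)// ltey_eq Xfin.
rewrite leeBrDr// addeC -leeBrDr//.
apply: lower_integral_le => [x Dx|E' s' mE' ED' ms' s0' sE' sf'].
  by rewrite lee_fin g0.
rewrite leeBrDr// -ge0_integralD//; first last.
- exact/measurable_EFinP.
- by move=> x _; rewrite lee_fin.
- exact/measurable_EFinP.
- by move=> x _; rewrite lee_fin.
apply: le_lower_integral => x.
- by move=> _; rewrite lee_fin addr_ge0.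
- by move=> Dx; rewrite lee_fin addr_ge0 ?f0 ?g0.
move=> _ ss'0.
have Dx : D x.
  have [/ED//|Ex] := pselect (E x); have [/ED'//|Ex'] := pselect (E' x).
  by move: ss'0; rewrite sE// sE'// adde0 ltxx.
split => //; rewrite -EFinD lee_fin [leLHS]addrC lerD//.
- by have [Ex|Ex] := pselect (E x); [exact: sf|rewrite sE// f0].
- by have [Ex|Ex] := pselect (E' x); [exact: sf'|rewrite sE'// g0].
Qed.

Lemma lower_integral_subadditive (O D : set T) (f g : T -> R) :
  measurable O -> D `<=` O -> measurable_fun O g ->
  (forall x, D x -> (0 <= f x)%R) -> (forall x, D x -> (0 <= g x)%R) ->
  \int[mu]_(x in D) (f x + g x)%:E <=
  \int[mu]_(x in D) (f x)%:E + \int[mu]_(x in D) (g x)%:E.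
Proof.
move=> mO DO mg f0 g0; apply: lower_integral_le => [x Dx|E s mE ED ms s0 sE sf].
  by rewrite lee_fin addr_ge0 ?f0 ?g0.
have mgE : measurable_fun E g.
  by apply: measurable_funS mg => //; exact: subset_trans DO.
have gE0 x : (0 <= (g \_ E) x)%R.
  by rewrite patchE; case: ifPn => //; rewrite inE => /ED/g0.
have mgE' : measurable_fun setT (g \_ E).
  by apply/(measurable_restrictT _ _).1.
(* What [s] leaves after removing [g]: it stays below [f], and it is measurable because [g] is, on
   the measurable set [E]. *)
pose s' x := Num.max (s x - (g \_ E) x)%R 0%R.
have ms' : measurable_fun setT s'.
  by apply: measurable_maxr => //; exact: measurable_funB.
have s'0 x : (0 <= s' x)%R by rewrite le_max lexx orbT.
apply: (@le_trans _ _ (\int[mu]_x ((s' x)%:E + ((g \_ E) x)%:E))).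
  apply: le_lower_integral => x; first by move=> _; rewrite lee_fin.
    by move=> _; rewrite -EFinD lee_fin addr_ge0.
  by move=> _ _; split => //; rewrite -EFinD lee_fin -lerBlDr le_max lexx.
rewrite ge0_integralD//; first last.
- exact/measurable_EFinP.
- by move=> x _; rewrite lee_fin.
- exact/measurable_EFinP.
- by move=> x _; rewrite lee_fin.
apply: leeD; apply: le_lower_integral => x.
- by move=> _; rewrite lee_fin.
- exact: f0.
- have [Ex _ _|Ex] := pselect (E x); last first.
    by rewrite /s' sE// patchE memNset// subrr maxxx ltxx.
  split; first exact: ED.
  rewrite lee_fin ge_max f0 ?andbT; last exact: ED.
  by rewrite patchE mem_set// lerBlDr -lee_fin sf.
- by move=> _; rewrite lee_fin.
- exact: g0.
- move=> _; rewrite patchE; case: ifPn => [|_]; last by rewrite ltxx.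
  by rewrite inE => Ex _; split; [exact: ED|].
Qed.

(** A measurable [s] below [f] may be cut off on a measurable null set containing [N]; what remains
    lies below [g]. *)
Lemma ae_le_lower_integral (D N : set T) (f g : T -> R) :
  mu.-negligible N ->
  (forall x, D x -> (0 <= f x)%R) -> (forall x, D x -> (0 <= g x)%R) ->
  (forall x, D x -> ~ N x -> (f x <= g x)%R) ->
  \int[mu]_(x in D) (f x)%:E <= \int[mu]_(x in D) (g x)%:E.
Proof.
move=> [B [mB B0 NB]] f0 g0 fg.
apply: lower_integral_le => [x Dx|E s mE ED ms s0 sE sf].
  by rewrite lee_fin f0.
rewrite (@ge0_negligible_integral _ _ _ _ _ B)//; last 2 first.
- exact/measurable_EFinP.
- by move=> x _; rewrite lee_fin.
apply: le_lower_integral => x; first by move=> _; rewrite lee_fin.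
  by move=> Dx; rewrite lee_fin g0.
move=> [_ Bx]; have [Ex _|Ex] := pselect (E x); last by rewrite sE// ltxx.
split; first exact: ED.
by rewrite (le_trans (sf x Ex))// lee_fin fg//; [exact: ED|move/NB].
Qed.

End lower_integral.

(** * Logarithmically convex profiles *)

Section convexity.
Context (R : realType).
Implicit Types (f l : R -> R).

Lemma convex_functionT_le l (t x y : R) :
  convex_function [set: R] l -> 0 <= t <= 1 ->
  l (t * x + (1 - t) * y) <= t * l x + (1 - t) * l y.
Proof.
move=> cl /andP[t0 t1].
have := cl (Itv01 t0 t1) x y; rewrite !inE => /(_ I I).
by rewrite !convRE.
Qed.

(** By convexity the difference quotient at [x] along [y - x] is at most [l y - l x] for every step
    in []0, 1]]; let the step tend to 0. *)
Lemma convex_tangent_le l (dl x y : R) : convex_function [set: R] l ->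
  is_derive x 1 l dl -> dl * (y - x) <= l y - l x.
Proof.
move=> cl [dl1 <-]; have dfl : differentiable l x by exact/derivable1_diffP.
have dv : derivable l x (y - x) by exact: diff_derivable.
have -> : 'D_1 l x * (y - x) = 'D_(y - x) l x.
  by rewrite !deriveE // -[in RHS](mulr1 (y - x)) linearZ mulrC.
have cv := cvg_dnbhs_at_right dv.
rewrite /derive -(cvg_lim _ cv)//; apply: limr_le; first exact: cvgP cv.
near=> h.
have h0 : 0 < h by near: h; exact: nbhs_right_gt.
have h1 : h <= 1 by near: h; exact: nbhs_right_le.
rewrite -[leLHS]/(h^-1 * _) /= ler_pdivrMl// lerBlDr.
have := @convex_functionT_le l h y x cl; rewrite (ltW h0) h1 => /(_ isT).
rewrite -[_ *: _]/(h * (y - x)).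
have -> : h * (y - x) + x = h * y + (1 - h) * x by ring.
by have -> : h * (l y - l x) + l x = h * l y + (1 - h) * l x by ring.
Unshelve. all: by end_near. Qed.

Lemma convex_derive_le l (dx dy x y : R) : convex_function [set: R] l ->
  is_derive x 1 l dx -> is_derive y 1 l dy -> x <= y -> dx <= dy.
Proof.
move=> cl lx ly; rewrite le_eqVlt => /predU1P[xy|xy].
  by move: lx ly; rewrite xy => -[_ <-] [_ <-].
have Hx := convex_tangent_le y cl lx; have Hy := convex_tangent_le x cl ly.
rewrite -(ler_pM2r (_ : 0 < y - x)) ?subr_gt0//.
by rewrite (le_trans Hx)// -lerN2 opprB -mulrN opprB.
Qed.

End convexity.

Section profile.
Context (R : realType) (f : R -> R).
Hypotheses (f_gt0 : forall t, 0 < f t) (f_der : forall t, derivable f t 1)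
  (f_logconvex : convex_function [set: R] (fun t => ln (f t)))
  (f0 : f 0 = 1).

Let f_cont : continuous f.
Proof. by move=> t; exact/differentiable_continuous/derivable1_diffP. Qed.

Lemma is_derive_ln_comp (t : R) : is_derive t 1 (fun t : R => ln (f t)) ((f t)^-1 * 'D_1 f t).
Proof.
have H := is_derive1_ln (f_gt0 t).
exact: (is_derive1_comp H (derivableP (@f_der t))).
Qed.

(** The tangent to [ln f] at [h], evaluated at 0 where [ln f] vanishes, gives
    [ln (f h) <= h * f' h / f h]. *)
Lemma logconvex_derive_gt0 h : 0 < h -> 1 < f h -> 0 < 'D_1 f h.
Proof.
move=> h0 fh1; have := convex_tangent_le 0 f_logconvex (is_derive_ln_comp h).
have lnfh : 0 < ln (f h) by rewrite ln_gt0.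
rewrite f0 ln1 !sub0r mulrN lerN2 => H.
have : 0 < (f h)^-1 * 'D_1 f h * h by rewrite (lt_le_trans lnfh).
by rewrite pmulr_lgt0// pmulr_rgt0// invr_gt0.
Qed.

(** For [0 <= u < v], convexity between 0 and [v] gives [ln (f u) <= (u / v) * ln (f v)], which is
    less than [ln (f v)] when [f v > 1]. *)
Lemma logconvex_inj h1 h2 : 0 <= h1 -> 0 <= h2 -> 1 < f h1 -> f h1 = f h2 -> h1 = h2.
Proof.
have lt_abs u v : 0 <= u -> u < v -> 1 < f u -> f u = f v -> False.
  move=> u0 uv fu fuv; have v0 : 0 < v by exact: le_lt_trans uv.
  have := @convex_functionT_le _ _ (u / v) v 0 f_logconvex.
  rewrite divr_ge0 ?(ltW v0)//= ler_pdivrMr// mul1r (ltW uv) => /(_ isT).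
  rewrite mulr0 addr0 divfK ?gt_eqF// f0 ln1 mulr0 addr0 fuv leNgt.
  rewrite gtr_pMl ?ltr_pdivrMr ?mul1r ?uv//.
  by rewrite ln_gt0// -fuv.
move=> h10 h20 fh1 fh; have [h12|h12|//] := ltgtP h1 h2; exfalso.
  exact: (lt_abs _ _ h10 h12).
by apply: (lt_abs _ _ h20 h12); rewrite -?fh.
Qed.

Lemma logconvex_surj a : ~ has_ubound (f @` [set t | 0 <= t]) -> 1 < a ->
  exists2 h, 0 < h & f h = a.
Proof.
move=> fub a1.
have [u u0 fu] : exists2 u, 0 <= u & a <= f u.
  apply: contrapT => H; apply: fub; exists a => _ [t t0 <-].
  by rewrite leNgt; apply/negP => ft; apply: H; exists t => //; exact: ltW.
have [|h hu fh] := @IVT R f 0 u a u0 (continuous_subspaceT f_cont).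
  by rewrite f0 ge_min (ltW a1) le_max fu orbT.
exists h => //; move: hu; rewrite in_itv/= => /andP[h0 _].
rewrite lt_neqAle h0 andbT; apply/eqP => h0'.
by move: a1; rewrite -fh -h0' f0 ltxx.
Qed.

Variables (n : nat) (P : R -> R).
Hypotheses (n_gt0 : (0 < n)%N)
  (P_der : forall x : R, 0 <= x -> is_derive x 1 P (f x ^+ n)).

(* [c * f ^+ n - P] is smallest at [h], as its derivative
   is [f ^+ n * ((ln f)' / (ln f)' h - 1)] *)
Lemma logconvex_primitive_le h : 0 < h -> 1 < f h ->
  exists2 c, 0 <= c & forall t, 0 <= t -> P t + c * f h ^+ n <= P h + c * f t ^+ n.
Proof.
move=> h0 fh1; have dfh := logconvex_derive_gt0 h0 fh1.
pose c := f h / (n%:R * 'D_1 f h).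
exists c; first by rewrite divr_ge0 ?mulr_ge0// ltW.
move=> t t0; pose psi (x : R) := c * f x ^+ n - P x.
pose dpsi (x : R) := f x ^+ n * (((f x)^-1 * 'D_1 f x) / ((f h)^-1 * 'D_1 f h) - 1).
have psiE (x : R) : 0 <= x -> is_derive x 1 psi (dpsi x).
  move=> x0; have dP := P_der x0; have df := derivableP (@f_der x).
  have -> : psi = c \*: (f ^+ n) - P by apply/funext => y; rewrite /psi !fctE.
  apply: is_derive_eq; rewrite /dpsi /c.
  case: n n_gt0 => [//|m] _ /=; rewrite exprS /GRing.scale/=; field.
  by rewrite !gt_eqF// ltr0n.
have psi_cont x y : 0 <= x -> {within `[x, y], continuous psi}.
  move=> x0; apply: derivable_within_continuous => z; rewrite in_itv/= => /andP[xz _].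
  by have [] := psiE z (le_trans x0 xz).
have Lh0 : 0 < (f h)^-1 * 'D_1 f h by rewrite mulr_gt0// invr_gt0.
suff : psi h <= psi t by rewrite /psi; lra.
have [th|ht|<-//] := ltgtP t h.
- have [z|z] := @MVT R psi dpsi t h th _ (psi_cont _ _ t0).
    by rewrite in_itv/= => /andP[tz _]; apply: psiE; rewrite (le_trans t0)// ltW.
  rewrite in_itv/= => /andP[tz zh] psiz; rewrite -subr_le0 psiz.
  rewrite mulr_le0_ge0 ?subr_ge0 ?(ltW th)// mulr_ge0_le0 ?exprn_ge0 ?(ltW (f_gt0 _))//.
  rewrite subr_le0 ler_pdivrMr// mul1r.
  exact: (convex_derive_le f_logconvex (is_derive_ln_comp z) (is_derive_ln_comp h) (ltW zh)).
- have [z|z] := @MVT R psi dpsi h t ht _ (psi_cont _ _ (ltW h0)).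
    by rewrite in_itv/= => /andP[tz _]; apply: psiE; rewrite (le_trans (ltW h0))// ltW.
  rewrite in_itv/= => /andP[hz zt] psiz; rewrite -subr_ge0 psiz.
  rewrite mulr_ge0 ?subr_ge0 ?(ltW ht)// mulr_ge0 ?exprn_ge0 ?(ltW (f_gt0 _))//.
  rewrite subr_ge0 ler_pdivlMr// mul1r.
  exact: (convex_derive_le f_logconvex (is_derive_ln_comp h) (is_derive_ln_comp z) (ltW hz)).
Qed.

End profile.

Lemma continuous_primitive_ge0 (R : realType) (F : R -> R) : continuous F ->
  exists2 P : R -> R, (forall x : R, 0 <= x -> is_derive x 1 P (F x)) &
    forall y, 0 <= y ->
      (\int[@lebesgue_measure R]_(t in `[0%R, y]) (F t)%:E = (P y)%:E)%E.
Proof.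
move=> Fc.
(* Starting at -1 makes 0 an interior point, so that the primitive has a two-sided derivative there;
   the value at 0 is subtracted afterwards. *)
pose P0 (x : R) := (\int[@lebesgue_measure R]_(t in `[(-1)%R, x]) F t)%R.
have dP0 (x : R) : -1 < x -> derivable P0 x 1 /\ derive1 P0 x = F x.
  move=> x1; apply: (@continuous_FTC1_closed _ F (-1) x (x + 1)) => //.
    by rewrite ltrDl.
  apply: continuous_compact_integrable; first exact: segment_compact.
    exact: continuous_subspaceT.
  exact: Fc.
have dP : forall x : R, 0 <= x -> is_derive x 1 (fun y : R => P0 y - P0 0) (F x).
  move=> x x0; have [|dx Dx] := dP0 x; first by rewrite (lt_le_trans _ x0)// ltrN10.
  have dPx := derivableP dx.
  by apply: is_derive_eq; rewrite subr0 -derive1E Dx.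
exists (fun x => P0 x - P0 0) => //.
have cP0 (x : R) : -1 < x -> {for x, continuous P0}.
  by move=> x1; apply/differentiable_continuous/derivable1_diffP; have [] := dP0 x x1.
move=> y; rewrite le_eqVlt => /predU1P[<-|y0].
  by rewrite set_itv1 integral_set1 subrr.
rewrite EFinB; apply: continuous_FTC2 => //.
- exact: continuous_subspaceT.
- split.
  + move=> x; rewrite in_itv/= => /andP[x0 _].
    by have [] := dP0 x (lt_trans (ltrN10 R) x0).
  + by apply: cvg_at_right_filter; apply: cP0; exact: ltrN10.
  + apply: cvg_at_left_filter; apply: cP0.
    by rewrite (lt_trans _ y0)// ltrN10.
- move=> x; rewrite in_itv/= => /andP[x0 _].
  by have [] := dP0 x (lt_trans (ltrN10 R) x0).
Qed.

(** * Riemannian volume of graphs and rooms *)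

(** The matrix determinant lemma: the two factorizations of the bordered matrix [M] exhibit the
    Schur complements of its two diagonal blocks. *)
Lemma det_rank1_update (K : fieldType) (n : nat) (A : 'M[K]_n) (w : 'rV[K]_n) :
  A \in unitmx ->
  \det (A + w^T *m w) = \det A * (1 + (w *m invmx A *m w^T) 0 0).
Proof.
move=> uA; pose M := block_mx (1%:M : 'M[K]_1) (- w) (w^T) A.
have M1 : M = block_mx 1%:M 0 (w^T) 1%:M *m block_mx 1%:M (- w) 0 (A + w^T *m w).
  rewrite mulmx_block !mulmx0 !mul0mx !mulmx1 !mul1mx !addr0 mulmxN.
  by rewrite addrCA addNr addr0.
have M2 : M = block_mx 1%:M (- (w *m invmx A)) 0 1%:M *m
    block_mx (1%:M + w *m invmx A *m w^T) 0 (w^T) A.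
  rewrite mulmx_block !mulmx0 !mul0mx !mul1mx !mulNmx !add0r.
  by rewrite addrK -mulmxA mulVmx// mulmx1.
have := congr1 determinant M2; rewrite {1}M1 !det_mulmx !det_lblock !det_ublock.
rewrite !det1 !mul1r => ->; rewrite mulrC; congr (_ * _).
by rewrite det_mx11 !mxE.
Qed.

(** The correction [w A^-1 w^T] is the value of the form [A] at [w A^-1], hence nonnegative. *)
Lemma det_rank1_update_ge (K : realFieldType) (n : nat) (A : 'M[K]_n) (w : 'rV[K]_n) :
  A^T = A -> (forall v : 'rV_n, v != 0 -> 0 < (v *m A *m v^T) 0 0) ->
  0 < \det A -> \det A <= \det (A + w^T *m w).
Proof.
move=> sA pA dA; have uA : A \in unitmx by rewrite unitmxE unitfE gt_eqF.
rewrite det_rank1_update// ler_peMr ?(ltW dA)// lerDl.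
have -> : w *m invmx A *m w^T = (w *m invmx A) *m A *m (w *m invmx A)^T.
  by rewrite trmx_mul trmx_inv sA mulmxKV// mulmxA.
have [->|/pA/ltW//] := eqVneq (w *m invmx A) 0.
by rewrite !mul0mx mxE.
Qed.

Lemma cvg_mx_entries (R : realType) (T : Type) (F : set_system T) (FF : Filter F)
    (m n : nat) (f : T -> 'M[R]_(m, n)) (A : 'M[R]_(m, n)) :
  (forall i j, f x i j @[x --> F] --> A i j) -> f x @[x --> F] --> A.
Proof.
move=> fA; apply/cvg_ballP => e e0.
have : \forall x \near F, forall ij : 'I_m * 'I_n, ball (A ij.1 ij.2) e (f x ij.1 ij.2).
  by apply: filter_forall => ij; have /cvg_ballP := fA ij.1 ij.2; exact.
by apply: filterS => x H; split => // i j; exact: (H (i, j)).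
Qed.

Section near_differential.
Context (R : numFieldType) (V W : normedModType R).

(** Serves to replace a graph read in charts by its formula, which is valid only on the open chart
    image. *)
Lemma near_eq_is_diff (f g df : V -> W) (x : V) :
  {near x, f =1 g} -> is_diff x f df -> is_diff x g df.
Proof.
move=> fg [dif dfE]; have fgx : f x = g x by exact: nbhs_singleton fg.
have cdf : continuous ('d f x) by exact: diff_continuous.
have e : g \o shift x = cst (g x) + 'd f x +o_ 0 id.
  apply/eqaddoP => e e0; move/diff_locally : dif => /eqaddoP/(_ e e0) H.
  have fg0 : \forall y \near 0, f (y + x) = g (y + x).
    by move: fg; rewrite (near_shift 0); apply: filterS => y; rewrite /= subr0.
  near=> y; have <- : (f \o shift x - (cst (f x) + 'd f x)) y =
      (g \o shift x - (cst (g x) + 'd f x)) y.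
    rewrite /GRing.add /GRing.opp /= -fgx; congr (_ - _).
    by near: y; exact: fg0.
  by near: y.
have dg := diff_unique cdf e.
by split; [apply/diff_locallyP; rewrite dg|rewrite dg].
Unshelve. all: by end_near. Qed.

End near_differential.

Section graph_jacobian.
Context (R : realType) (n : nat).

Lemma continuous_mulmxr (m p : nat) (A : 'M[R]_(m, p)) :
  continuous (mulmxr A : 'rV[R]_m -> 'rV[R]_p).
Proof.
move=> v; apply: (cvg_mx_entries (nbhs_filter v)) => i j.
rewrite [X in X @ _ --> _](_ : _ = fun u : 'rV[R]_m => \sum_k u i k * A k j); last first.
  by apply/funext => u; rewrite mxE.
rewrite mxE; apply: cvg_big => [|k _].
- exact: add_continuous.
- by apply: cvgM; [exact: coord_continuous|exact: cvg_cst].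
Qed.

Lemma jacobian_graph (gam : 'rV[R]_n -> R) (psi : 'rV[R]_n -> 'rV[R]_(1 + n))
    (x : 'rV[R]_n) :
  differentiable gam x -> (\forall y \near x, psi y = row_mx (gam y)%:M y) ->
  'J psi x = row_mx (\col_i 'd gam x (delta_mx 0 i)) 1%:M.
Proof.
move=> dg psiE.
(* The graph map is split as [gam y *: e + y *m L]: a scalar function times a fixed vector, plus a
   linear map. *)
pose e : 'rV[R]_(1 + n) := row_mx 1%:M 0.
pose L : 'M[R]_(n, 1 + n) := row_mx 0 1%:M.
have dL : is_diff x (mulmxr L) (mulmxr L).
  split; first by apply: linear_differentiable; exact: continuous_mulmxr.
  by rewrite diff_lin//; exact: continuous_mulmxr.
have de : is_diff x (fun y => gam y *: e) (fun v => 'd gam x v *: e).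
  by split; [exact: differentiableZl|rewrite diffZl].
have rowE (a : R) (v : 'rV[R]_n) : a *: e + v *m L = row_mx a%:M v.
  rewrite /e /L scale_row_mx mul_mx_row mulmx1 mulmx0 scaler0 add_row_mx addr0 add0r.
  by rewrite scalemx1.
have : is_diff x psi (fun v => row_mx ('d gam x v)%:M v).
  have -> : (fun v => row_mx ('d gam x v)%:M v) =
      (fun v => 'd gam x v *: e) + mulmxr L.
    by apply/funext => v; rewrite -rowE.
  apply: near_eq_is_diff (is_diffD de dL).
  by near=> y; rewrite (near psiE y)// -rowE.
move=> [_ dpsi]; rewrite /jacobian; apply/matrixP => i j.
rewrite [LHS]mxE dpsi; case: (splitP j) => k jk.
- have -> : j = lshift n k by exact/val_inj.
  by rewrite !row_mxEl !mxE !ord1 eqxx mulr1n.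
- have -> : j = rshift 1 k by exact/val_inj.
  by rewrite !row_mxEr !mxE eqxx eq_sym.
Unshelve. all: by end_near. Qed.

End graph_jacobian.

Lemma chart_atE (R : realType) (T : Type) (n : nat)
    (M : metric_atlas R T n) (i : nat) (p : T) :
  chart_piece M i p -> chart_at M p = i.
Proof.
move=> pi; rewrite /chart_at; case: xgetP => [j _ pj|/(_ i)//].
by apply: (trivIset_seqDU (chart_dom M)) => //; exists p.
Qed.

Lemma chart_piece_warped (R : realType) (T : Type) (n : nat) (f : R -> R)
    (N : metric_atlas R T n) (i : nat) :
  chart_piece (warped_product f N) i = [set p | chart_piece N i p.2].
Proof.
apply/seteqP; split => p; rewrite /chart_piece /seqDU => -[pi pni];
  split => //; move: pni; apply: contra_not; rewrite -!bigcup_mkord => -[j ji pj];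
  by exists j.
Qed.

(** * Densities of graphs and rooms in one chart *)

Section manifold.
Context (R : realType) (T : topologicalType) (n : nat) (N : metric_atlas R T n).
Hypothesis N_riemannian : is_riemannian_manifold N.

Lemma chart_imgT_open i : open (chart_img N i setT).
Proof. by have [_ [_ [/(_ i)[]]]] := N_riemannian. Qed.

Lemma coordK i q : chart_dom N i q -> param N i (coord N i q) = q.
Proof.
by move=> iq; have [_ [_ [/(_ i)[_ _ + _ _] _]]] := N_riemannian; apply; rewrite inE.
Qed.

Lemma chart_imgT_param i x : chart_img N i setT x ->
  chart_dom N i (param N i x) /\ coord N i (param N i x) = x.
Proof. by move=> [q [_ iq] <-]; rewrite coordK. Qed.

Lemma chart_img_subT i E : chart_img N i E `<=` chart_img N i setT.
Proof. by move=> _ [q [_ iq] <-]; exists q. Qed.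

Lemma chart_imgP i E x : chart_img N i E x <->
  chart_img N i setT x /\ E (param N i x).
Proof.
split=> [[q [Eq iq] <-]|[[q [_ iq] <-]]]; first by rewrite coordK//; split => //; exists q.
by rewrite coordK// => Eq; exists q.
Qed.

Lemma param_continuous i x : chart_img N i setT x -> {for x, continuous (param N i)}.
Proof. by have [_ [_ [/(_ i)[_ _ _ _ +] _]]] := N_riemannian; apply. Qed.

Lemma metric_sym i x : chart_img N i setT x -> (metric N i x)^T = metric N i x.
Proof. by have [_ [_ [_ [_ [_ [+ _]]]]]] := N_riemannian; move=> /[apply] -[]. Qed.

Lemma metric_pos i x (v : 'rV_n) : chart_img N i setT x -> v != 0 ->
  0 < (v *m metric N i x *m v^T) 0 0.
Proof.
by have [_ [_ [_ [_ [_ [+ _]]]]]] := N_riemannian; move=> /[apply] -[_]; exact.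
Qed.

Lemma metric_continuous i x : chart_img N i setT x -> {for x, continuous (metric N i)}.
Proof. by have [_ [_ [_ [_ [+ _]]]]] := N_riemannian; move=> /(_ i 0%N); exact. Qed.

Definition volume_density i (x : 'rV[R]_n) : R := Num.sqrt (\det (metric N i x)).

Lemma volume_density_ge0 i x : 0 <= volume_density i x.
Proof. exact: sqrtr_ge0. Qed.

Lemma volume_density_continuous i x : chart_img N i setT x ->
  {for x, continuous (volume_density i)}.
Proof.
move=> ix; have cm := metric_continuous ix.
apply: (@continuous_comp _ _ _ (fun x => \det (metric N i x)) Num.sqrt); last first.
  exact: sqrt_continuous.
have xF := nbhs_filter x.
rewrite /continuous_at /determinant.
apply: cvg_big => [|s _]; first exact: add_continuous.
apply: cvgM; first exact: cvg_cst.
apply: cvg_big => [|a _]; first exact: mul_continuous.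
exact: (continuous_comp cm (@coord_continuous _ _ _ _ _ _)).
Qed.

Variable f : R -> R.
Hypothesis f_gt0 : forall t, 0 < f t.

Section graph.
Variables (g : T -> R) (i : nat) (x : 'rV[R]_n).
Hypothesis ix : chart_img N i (chart_piece N i) x.

Lemma pullback_graph : differentiable (g \o param N i) x ->
  pullback_metric (warped_product f N) ((fun q => (g q, q)) \o param N i) x =
  f (g (param N i x)) ^+ 2 *: metric N i x +
  (\row_k 'd (g \o param N i) x (delta_mx 0 k))^T *m
  (\row_k 'd (g \o param N i) x (delta_mx 0 k)).
Proof.
move=> dg; have [iT ip] := (chart_imgP _ _ _).1 ix.
have [idom coordx] := chart_imgT_param iT.
(* On the [i]-th piece the chart selected around the image point is the [i]-th one, so no transition
   map enters the Jacobian. *)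
rewrite /pullback_metric (@chart_atE _ _ _ _ i); last first.
  by rewrite chart_piece_warped.
set J := 'J _ x.
have -> : J = row_mx (\row_k 'd (g \o param N i) x (delta_mx 0 k))^T 1%:M.
  rewrite /J (jacobian_graph dg).
    by congr row_mx; apply/matrixP => a b; rewrite !mxE.
  have : nbhs x (chart_img N i setT).
    by apply: open_nbhs_nbhs; split => //; exact: chart_imgT_open.
  by apply: filterS => y /chart_imgT_param[_ /= ->].
rewrite /= row_mxKl row_mxKr coordx mul_row_block !mulmx0 mulmx1 mul1mx add0r addr0.
rewrite tr_row_mx mul_row_col trmx1 mulmx1 trmxK addrC; congr (_ *: _ + _).
by rewrite mxE eqxx mulr1n.
Qed.

Lemma volume_density_warped (t : R) (y : 'rV[R]_n) :
  Num.sqrt (\det (f t ^+ 2 *: metric N i y)) = f t ^+ n * volume_density i y.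
Proof.
rewrite detZ -exprM mulnC exprM sqrtrM ?sqr_ge0// sqrtr_sqr ger0_norm//.
by rewrite exprn_ge0// ltW.
Qed.

Lemma graph_density_ge : differentiable (g \o param N i) x ->
  f (g (param N i x)) ^+ n * volume_density i x <=
  Num.sqrt (\det (pullback_metric (warped_product f N)
    ((fun q => (g q, q)) \o param N i) x)).
Proof.
move=> dg; rewrite pullback_graph// -volume_density_warped.
set A := _ *: _; set w := \row_k _; set c := f _ ^+ 2 in A *.
have c0 : 0 < c by rewrite exprn_gt0.
have iT : chart_img N i setT x by have [] := (chart_imgP _ _ _).1 ix.
(* The sign of the determinant need not be derived from positive definiteness: if it is not
   positive, the left square root is 0. *)
have [dA|dA] := leP (\det A) 0.
  by rewrite ler0_sqrtr// sqrtr_ge0.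
rewrite ler_wsqrtr// det_rank1_update_ge//.
  by rewrite /A linearZ /= metric_sym.
move=> v v0; rewrite /A -scalemxAr -scalemxAl mxE mulr_gt0//.
exact: metric_pos.
Qed.

End graph.

Lemma graph_density_cst (h : R) (i : nat) (x : 'rV[R]_n) :
  chart_img N i (chart_piece N i) x ->
  Num.sqrt (\det (pullback_metric (warped_product f N)
    ((fun q => (h, q)) \o param N i) x)) = f h ^+ n * volume_density i x.
Proof.
move=> ix; have dh : differentiable ((fun=> h) \o param N i) x.
  exact: differentiable_cst.
rewrite (pullback_graph ix dh) -volume_density_warped.
rewrite [X in X^T](_ : _ = 0) ?trmx0 ?mul0mx ?addr0//.
apply/rowP => k; rewrite !mxE.
by rewrite (_ : _ \o _ = cst h)// diff_cst.
Qed.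

Lemma room_density (i : nat) (x : 'rV[R]_(1 + n)) :
  Num.sqrt (\det (metric (warped_product f N) i x)) =
  f (lsubmx x 0 0) ^+ n * volume_density i (rsubmx x).
Proof. by rewrite /= det_ublock det1 mul1r volume_density_warped. Qed.

Lemma chart_img_room (F : set T) (g : T -> R) (i : nat) (x : 'rV[R]_(1 + n)) :
  chart_img (warped_product f N) i (room F g `&` chart_piece (warped_product f N) i) x
  <-> chart_img N i (F `&` chart_piece N i) (rsubmx x) /\
      0 <= lsubmx x 0 0 <= g (param N i (rsubmx x)).
Proof.
rewrite chart_piece_warped; split.
  move=> [[t q] /= [[[Fq tg] qi] iq] <-]; rewrite row_mxKl row_mxKr mxE eqxx mulr1n.
  by rewrite coordK//; split => //; exists q.
move=> [[q [[Fq qi] iq] qx]]; rewrite -qx coordK// => tg.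
exists (lsubmx x 0 0, q); first by [].
rewrite /= qx -[RHS]hsubmxK; congr row_mx.
by apply/matrixP => a b; rewrite !ord1 !mxE eqxx mulr1n.
Qed.

End manifold.

(** * Fubini over a subgraph *)

Section subgraph_integral.
Local Open Scope ereal_scope.
Context (R : realType) (n : nat).
Let mu := lebesgue_tuple R n.
Let leb := @lebesgue_measure R.

Lemma integral_lebesgue_tupleS (s : n.+1.-tuple (measurableTypeR R) -> R) :
  measurable_fun setT s -> (forall u, (0 <= s u)%R) ->
  \int[lebesgue_tuple R n.+1]_u (s u)%:E =
  \int[mu]_t \int[leb]_a (s (tcons (a, t)))%:E.
Proof.
move=> ms s0.
have ms' : measurable_fun setT (EFin \o s) by exact/measurable_EFinP.
rewrite -(fubini_tonelli2 (fun p => (s (tcons p))%:E)); last 2 first.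
- exact: (measurableT_comp ms' (@measurable_tcons R n)).
- by move=> p; rewrite lee_fin.
have := @ge0_integral_pushforward _ _ _ _ R _ (@measurable_tcons R n)
  (leb \x mu)%E setT (EFin \o s) measurableT ms'.
rewrite preimage_setT; apply.
by move=> u _; rewrite /= lee_fin.
Qed.

Variables (F P : R -> R) (D : set (n.+1.-tuple (measurableTypeR R)))
  (phi : n.+1.-tuple (measurableTypeR R) -> R)
  (D0 : set (n.-tuple (measurableTypeR R)))
  (rho : n.-tuple (measurableTypeR R) -> R).
Hypotheses (F_cont : continuous F) (F_ge0 : forall a, (0 <= F a)%R)
  (P_int : forall y, (0 <= y)%R -> \int[leb]_(a in `[0%R, y]) (F a)%:E = (P y)%:E)
  (rho_ge0 : forall t, (0 <= rho t)%R)
  (phiE : forall a t, phi (tcons (a, t)) = (F a * rho t)%R).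

Let P_ge0 y : (0 <= y)%R -> (0 <= P y)%R.
Proof.
by move=> y0; rewrite -lee_fin -P_int// integral_ge0// => a _; rewrite lee_fin.
Qed.

Lemma tcons_surj (u : n.+1.-tuple (measurableTypeR R)) : exists p, u = tcons p.
Proof. by exists (thead u, [tuple of behead u]); rewrite [LHS]tuple_eta; exact/val_inj. Qed.

(** Tonelli is applied only to a measurable [s] supported in [D] and below [phi]; its slice over [t]
    lives on [[0, g t]], so its integral is at most [P (g t) * rho t]. *)
Lemma subgraph_integral_le (g : n.-tuple (measurableTypeR R) -> R) :
  (forall a t, D (tcons (a, t)) <-> D0 t /\ (0 <= a <= g t)%R) ->
  (forall t, D0 t -> (0 <= g t)%R) ->
  \int[lebesgue_tuple R n.+1]_(u in D) (phi u)%:E <=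
  \int[mu]_(t in D0) (P (g t) * rho t)%:E.
Proof.
move=> DE g0; apply: lower_integral_le => [u _|E s mE ED ms s0 sE sphi].
  by have [[a t] ->] := tcons_surj u; rewrite lee_fin phiE mulr_ge0.
rewrite integral_lebesgue_tupleS//; apply: le_lower_integral => t.
- by move=> _; apply: integral_ge0 => a _; rewrite lee_fin.
- by move=> Dt; rewrite lee_fin mulr_ge0// P_ge0// g0.
move=> _ st; have Dt : D0 t.
  apply: contrapT => Dt; move: st; rewrite integral0_eq ?ltxx// => a _.
  by rewrite sE// => /ED/DE[].
split => //; rewrite mulrC EFinM -P_int ?g0// -lower_integralZl//.
apply: le_lower_integral => a; first by move=> _; rewrite lee_fin.
  by move=> _; rewrite lee_fin mulr_ge0.
have [Ea _ _|Ea] := pselect (E (tcons (a, t))); last by rewrite sE// ltxx.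
have /DE[_ ag] := ED _ Ea; split; first by rewrite /= in_itv.
by rewrite mulrC -phiE; exact: sphi.
Qed.

(** At constant height, a measurable [s] below [rho] lifts to the product [S] of [s] with [F] cut
    off to [[0, h]]: it is measurable, lies below [phi], and integrates to [P h] times the integral
    of [s]. *)
Lemma subgraph_integral_cst_ge (h : R) : (0 <= h)%R ->
  (forall a t, D (tcons (a, t)) <-> D0 t /\ (0 <= a <= h)%R) ->
  (P h)%:E * \int[mu]_(t in D0) (rho t)%:E <=
  \int[lebesgue_tuple R n.+1]_(u in D) (phi u)%:E.
Proof.
move=> h0 DE; have phi0 u : (0 <= phi u)%R.
  by have [[a t] ->] := tcons_surj u; rewrite phiE mulr_ge0.
have := P_ge0 h0; rewrite le_eqVlt => /predU1P[<-|Ph].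
  by rewrite mul0e integral_ge0// => u _; rewrite lee_fin.
rewrite -lee_pdivlMl//; apply: lower_integral_le => [t _|E s mE ED ms s0 sE srho].
  by rewrite lee_fin.
rewrite lee_pdivlMl//.
pose F1 : R -> R := F \_ `[0%R, h].
have mF : measurable_fun setT F by exact: continuous_measurable_fun.
have mF1 : measurable_fun setT F1.
  by apply/(measurable_restrictT _ _).1 => //; exact: measurable_funTS.
have F10 a : (0 <= F1 a)%R by rewrite /F1 patchE; case: ifP.
pose S (u : n.+1.-tuple (measurableTypeR R)) : R := (F1 (thead u) * s [tuple of behead u])%R.
have S_tcons a t : S (tcons (a, t)) = (F1 a * s t)%R.
  rewrite /S /thead tnth0; congr (_ * s _)%R; exact/val_inj.
have S0 u : (0 <= S u)%R by rewrite mulr_ge0.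
have mS : measurable_fun setT S.
  apply: measurable_funM.
    by apply: (measurableT_comp mF1); exact: measurable_tnth.
  by apply: (measurableT_comp ms); exact: measurable_behead.
have -> : (P h)%:E * \int[mu]_t (s t)%:E = \int[lebesgue_tuple R n.+1]_u (S u)%:E.
  rewrite integral_lebesgue_tupleS// -ge0_integralZl_EFin//; last 3 first.
  - by move=> t _; rewrite lee_fin.
  - exact/measurable_EFinP.
  - exact: ltW.
  apply: eq_integral => t _.
  under eq_integral do rewrite S_tcons mulrC.
  rewrite lower_integralZl//.
  rewrite -P_int// muleC; congr (_ * _); rewrite [LHS]integral_mkcond; apply: eq_integral => a _.
  by rewrite /F1 !patchE; case: ifP.
apply: le_lower_integral => u; [by move=> _; rewrite lee_fin|by move=> _; rewrite lee_fin|].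
have [[a t] ->] := tcons_surj u; move=> _; rewrite S_tcons lte_fin.
have [Et|Et] := pselect (E t); last by rewrite sE// mulr0 ltxx.
rewrite /F1 patchE; case: ifPn => [|_]; last by rewrite mul0r ltxx.
rewrite inE/= in_itv/= => ah _; split; first by apply/DE; split => //; exact: ED.
by rewrite lee_fin phiE ler_wpM2l// -lee_fin srho.
Qed.

End subgraph_integral.

(** * Negligible sets *)

Section rational_balls.
Context (R : realType) (n : nat).

(** A base of the topology indexed by [nat]; integers that code no pair give the empty set. *)
Definition rational_ball (k : nat) : set 'rV[R]_n :=
  if @unpickle ('rV[rat]_n * nat)%type k is Some p
  then ball (map_mx ratr p.1 : 'rV[R]_n) (p.2.+1%:R^-1) else set0.

Lemma rational_ball_nbhs (x : 'rV[R]_n) (V : set 'rV[R]_n) : nbhs x V ->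
  exists k, rational_ball k x /\ rational_ball k `<=` V.
Proof.
move=> /nbhs_ballP[e e0 eV]; set k := Num.truncn (2 / e).
have e20 : 0 < e / 2 by rewrite divr_gt0.
have k0 : 0 < k.+1%:R^-1 :> R by rewrite invr_gt0.
have ke : k.+1%:R^-1 < e / 2.
  by rewrite -[ltRHS]invrK ltf_pV2 ?posrE ?invr_gt0// invf_div truncnS_gt.
have /choice[c cx] : forall j, exists q : rat, `|x 0 j - ratr q| < k.+1%:R^-1.
  move=> j; have [|q] := @rat_in_itvoo R (x 0 j - k.+1%:R^-1) (x 0 j + k.+1%:R^-1).
    by rewrite ltrD2l (lt_trans _ k0)// oppr_lt0.
  by rewrite in_itv/= => qx; exists q; rewrite distrC ltr_distl.
exists (pickle (\row_j c j, k)); rewrite /rational_ball pickleK /=.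
have xb : ball (map_mx (@ratr R) (\row_j c j)) k.+1%:R^-1 x.
  by split => // i j; rewrite !ord1 !mxE /ball/= distrC.
split => // y yb; apply: eV; rewrite (splitr e).
apply: (@ball_triangle _ _ (map_mx (@ratr R) (\row_j c j))). 
  by apply: ball_sym; exact: le_ball (ltW ke) _ xb.
exact: le_ball (ltW ke) _ yb.
Qed.

Lemma measurable_row_of_tuple_ball (c : 'rV[R]_n) (e : R) :
  measurable (@row_of_tuple R n @^-1` ball c e).
Proof.
have [e0|e0] := ltP 0 e; last first.
  rewrite (_ : _ @^-1` _ = set0)//; apply/seteqP; split => // t [].
  by rewrite ltNge e0.
rewrite (_ : _ @^-1` _ =
    \bigcap_(j in [set: 'I_n]) ((@tnth n (measurableTypeR R) ^~ j) @^-1` ball (c 0 j) e)).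
  apply: fin_bigcap_measurable => // j _; rewrite -[X in measurable X]setTI.
  by apply: measurable_tnth => //; exact: measurable_ball.
apply/seteqP; split => t /=.
  by move=> [_ H] j _; have := H 0 j; rewrite !mxE.
by move=> H; split => // i j; rewrite !ord1 !mxE; exact: H.
Qed.

(** Tuples carry the product sigma-algebra, which meets the topology of row vectors through boxes:
    an open set is a countable union of rational balls, and these are boxes for the sup norm. *)
Lemma measurable_row_of_tuple_open (O : set 'rV[R]_n) :
  open O -> measurable (@row_of_tuple R n @^-1` O).
Proof.
rewrite openE => oO.
rewrite (_ : O = \bigcup_(k in [set k | rational_ball k `<=` O]) rational_ball k).
  rewrite preimage_bigcup; apply: bigcup_measurable => k _; rewrite /rational_ball.
  case: unpickle => [p|]; first exact: measurable_row_of_tuple_ball.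
  by rewrite preimage_set0.
apply/seteqP; split => [x /oO/rational_ball_nbhs[k [kx kO]]|x [k kO kx]].
  by exists k.
exact: kO.
Qed.

Lemma measurable_comp_row_of_tuple (O : set 'rV[R]_n) (f : 'rV[R]_n -> R) :
  open O -> (forall x, O x -> {for x, continuous f}) ->
  measurable_fun (@row_of_tuple R n @^-1` O) (f \o @row_of_tuple R n).
Proof.
move=> oO cf mO; apply: (measurability _ (RGenOInfty.measurableE R)) => //.
move=> _ [_ [a ->] <-].
rewrite (_ : _ `&` _ = @row_of_tuple R n @^-1` (O `&` f @^-1` `]a, +oo[%classic))//.
apply: measurable_row_of_tuple_open; rewrite openE => x [Ox fx].
have Vx : nbhs (f x) `]a, +oo[%classic.
  by apply: open_nbhs_nbhs; split => //; exact: interval_open.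
apply: filterI; last exact: cf.
by apply: open_nbhs_nbhs.
Qed.

Lemma rV_negligibleS (A B : set 'rV[R]_n) :
  A `<=` B -> rV_negligible B -> rV_negligible A.
Proof. by move=> AB; apply: negligibleS => t; exact: AB. Qed.

Lemma rV_negligible_bigcup (A : nat -> set 'rV[R]_n) :
  (forall k, rV_negligible (A k)) -> rV_negligible (\bigcup_k A k).
Proof.
by move=> A0; rewrite /rV_negligible preimage_bigcup; exact: negligible_bigcup.
Qed.

Lemma rV_negligible_locally (A : set 'rV[R]_n) :
  (forall x, A x -> exists2 V, nbhs x V & rV_negligible (A `&` V)) ->
  rV_negligible A.
Proof.
(* A Lindelöf argument: [B k] is empty unless the [k]-th ball meets [A] in a null set, so the union
   can run over all [k]. *)
move=> AV; pose B k := [set x | (A `&` rational_ball k) x /\ rV_negligible (A `&` rational_ball k)].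
apply: (@rV_negligibleS _ (\bigcup_k B k)).
  move=> x Ax; have [V xV AV0] := AV x Ax.
  have [k [kx kV]] := rational_ball_nbhs xV; exists k => //; split => //.
  by apply: rV_negligibleS AV0; exact: setIS.
apply: rV_negligible_bigcup => k.
have [k0|k0] := pselect (rV_negligible (A `&` rational_ball k)).
  by apply: rV_negligibleS k0 => x [].
rewrite /rV_negligible (_ : _ @^-1` _ = set0); first exact: negligible_set0.
by apply/seteqP; split => // t [].
Qed.

End rational_balls.

Section cubes.
Context (R : realType).

Definition closed_cube (n : nat) (c : 'I_n -> R) (r : R) :
    set (n.-tuple (measurableTypeR R)) :=
  [set t | forall j, `|tnth t j - c j| <= r].

Lemma closed_cubeE (n : nat) (c : 'I_n -> R) (r : R) : closed_cube c r =
  \bigcap_(j in [set: 'I_n]) ((@tnth n (measurableTypeR R) ^~ j) @^-1` `[c j - r, c j + r]).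
Proof.
apply/seteqP; split => t /= H j => [_|]; first by rewrite /= in_itv/= -ler_distl.
by have := H j I; rewrite /= in_itv/= -ler_distl.
Qed.

Lemma measurable_closed_cube (n : nat) (c : 'I_n -> R) (r : R) :
  measurable (closed_cube c r).
Proof.
rewrite closed_cubeE; apply: fin_bigcap_measurable => // j _.
rewrite -[X in measurable X]setTI.
by apply: measurable_tnth => //; exact: measurable_itv.
Qed.

Lemma lebesgue_tuple_closed_cube (n : nat) (c : 'I_n -> R) (r : R) : 0 <= r ->
  lebesgue_tuple R n (closed_cube c r) = ((2 * r) ^+ n)%:E.
Proof.
move=> r0; elim: n c => [|n ih] c.
  by rewrite /= diracE mem_set ?expr0// => -[].
have e : @tcons R n @^-1` closed_cube c r =
    `[c ord0 - r, c ord0 + r]%classic `*` closed_cube (fun j => c (lift ord0 j)) r.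
  apply/seteqP; split => [[a t] /= H|[a t] /= [H0 H]].
    split => [|j]; first by have := H ord0; rewrite tnth0 /= in_itv/= -ler_distl.
    by have := H (lift ord0 j); rewrite tnthS.
  move=> j; case: (unliftP ord0 j) => [k|] ->; first by rewrite tnthS; exact: H.
  by move: H0; rewrite tnth0 in_itv/= -ler_distl.
rewrite /= /lebesgue_succ /pushforward e product_measure1E//; last first.
  exact: measurable_closed_cube.
rewrite ih exprS EFinM; congr (_ * _)%E.
apply: etrans (lebesgue_measure_itv `[c ord0 - r, c ord0 + r]) _.
rewrite /= lte_fin; case: ltP => [_|]; first by rewrite -EFinD; congr EFin; ring.
by rewrite lerD2l => rr; have -> : r = 0; [lra|rewrite mulr0].
Qed.

End cubes.

Lemma measure_bigsetU_le (d : measure_display) (T : measurableType d) (R : realType)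
    (mu : {measure set T -> \bar R}) (I : Type) (s : seq I) (A : I -> set T) :
  (forall i, measurable (A i)) ->
  (mu (\big[setU/set0]_(i <- s) A i) <= \sum_(i <- s) mu (A i))%E.
Proof.
move=> mA; elim: s => [|i s ih]; first by rewrite !big_nil measure0.
rewrite !big_cons; apply: le_trans (leeD2l _ ih).
by apply: measureU2 => //; exact: bigsetU_measurable.
Qed.

(** * Null images of sets of lower dimension *)

Section lipschitz_image.
Context (R : realType) (m n : nat) (h : 'rV[R]_m -> 'rV[R]_n).

(** The differential has a bound [k] and the remainder is eventually at most [|z - y|], whence the
    constant [k + 1]. One integer fixes both the constant and the radius, so that countably many
    cases exhaust the domain. *)
Lemma differentiable_pointwise_lipschitz (y : 'rV[R]_m) : differentiable h y ->
  exists M : nat, forall z, `|z - y| < M.+1%:R^-1 -> `|h z - h y| <= M.+1%:R * `|z - y|.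
Proof.
move=> dh; have /eqaddoP/(_ 1 ltr01)/nbhs_ballP[e e0 He] := diff_locally dh.
have [k k0 Hk] := linear_lipschitz (diff_continuous dh).
have Mmax : Num.max (k + 1) e^-1 < (Num.truncn (Num.max (k + 1) e^-1)).+1%:R.
  exact: truncnS_gt.
exists (Num.truncn (Num.max (k + 1) e^-1)) => z zy; move: Mmax zy.
set M := _.+1 => Mmax zy; have M0 : 0 < M%:R :> R by rewrite ltr0n.
have kM : k + 1 < M%:R by rewrite (le_lt_trans _ Mmax)// le_max lexx.
have eM : M%:R^-1 < e.
  rewrite -[ltRHS]invrK ltf_pV2 ?posrE ?invr_gt0//.
  by rewrite (le_lt_trans _ Mmax)// le_max lexx orbT.
have : ball (0 : 'rV[R]_m) e (z - y).
  by rewrite -ball_normE /= sub0r normrN (lt_trans zy).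
move=> /He /=; rewrite !mul1r => H.
rewrite (_ : h z - h y = (h \o shift y - (cst (h y) + 'd h y)) (z - y) + 'd h y (z - y)); last first.
  by rewrite !fctE /= subrK opprD addrA subrK.
apply: (le_trans (ler_normD _ _)).
apply: (@le_trans _ _ (`|z - y| + k * `|z - y|)); first exact: lerD.
by rewrite -{1}[`|z - y|]mul1r -mulrDl addrC ler_wpM2r// ltW.
Qed.

Hypothesis mn : (m < n)%N.

(* Each of the [(K + 1) ^ m] cells of side [1 / K] of the unit cube is sent into a
   cube of side [2 * M.+1 / K], and [m < n]. *)
Lemma lipschitz_image_negligible (Y : set 'rV[R]_m) (M : nat) :
  Y `<=` @unit_cube R m ->
  (forall y z, Y y -> `|z - y| < M.+1%:R^-1 -> `|h z - h y| <= M.+1%:R * `|z - y|) ->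
  rV_negligible (h @` Y).
Proof.
move=> Y1 Yh; pose M' : R := M.+1%:R.
have M'0 : 0 < M' by rewrite ltr0n.
(* Starting at [M.+1] keeps the cells within the radius on which the Lipschitz bound holds. *)
pose K k := (M.+1 + k)%N.
have K0 k : 0 < (K k)%:R :> R by rewrite ltr0n.
(* A coordinate equal to 1 has index [K k], hence [K k + 1] indices per axis. *)
pose cell k (y : 'rV[R]_m) : {ffun 'I_m -> 'I_(K k).+1} :=
  [ffun j => inord (Num.truncn ((K k)%:R * y 0 j))].
(* A sample point of [Y] in each cell; the default 0 for cells missing [Y] only adds harmless
   cubes. *)
pose c k (a : {ffun _ -> _}) : 'rV[R]_m := xget 0 [set y | Y y /\ cell k y = a].
pose U k := \big[setU/set0]_(a : {ffun 'I_m -> 'I_(K k).+1})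
  closed_cube (fun j => h (c k a) 0 j) (M' / (K k)%:R).
have mU k : measurable (U k).
  by apply: bigsetU_measurable => a _; exact: measurable_closed_cube.
have YU k : @row_of_tuple R n @^-1` (h @` Y) `<=` U k.
  move=> t [z Yz hz]; set y := c k (cell k z).
  have [Yy yz] : Y y /\ cell k y = cell k z.
    by rewrite /y /c; case: xgetP => [? _//|/(_ z)]; case.
  rewrite /U -bigcup_seq; exists (cell k z); first by rewrite /= mem_index_enum.
  have zy : `|z - y| < (K k)%:R^-1.
    have : ball y (K k)%:R^-1 z.
      split; first by rewrite invr_gt0.
      move=> i j; rewrite ord1 /ball/= -(ltr_pM2l (K0 k)) divff ?gt_eqF//.
      rewrite -[X in X * _]gtr0_norm// -normrM mulrBr.
      have := congr1 (fun a : {ffun _ -> _} => val (a j)) yz; rewrite !ffunE.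
      have tK w : Y w -> (Num.truncn ((K k)%:R * w 0 j)%R < (K k).+1)%N /\ 0 <= (K k)%:R * w 0 j.
        move=> /Y1/(_ j)/andP[w0 w1]; rewrite mulr_ge0 ?(ltW (K0 k))//; split => //.
        rewrite ltnS truncn_le_nat; apply: (le_lt_trans _ (_ : (K k)%:R < _)).
          by rewrite ler_piMr// ltW.
        by rewrite ltr_nat.
      have [ty y0] := tK y Yy; have [tz z0] := tK z Yz.
      rewrite /= !inordK// => e; move: (truncn_itv y0) (truncn_itv z0); rewrite e.
      rewrite ltr_distl => /andP[y1 y2] /andP[z1 z2].
      move: y1 y2 z1 z2; rewrite -!natr1; move: (_%:R) => q.
      move: (_ * y 0 j) (_ * z 0 j) => u v; lra.
    by rewrite -ball_normE /= distrC.
  have hzy : `|h z - h y| <= M' / (K k)%:R.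
    apply: (@le_trans _ _ (M' * `|z - y|)); last by rewrite ler_wpM2l// ltW.
    apply: Yh => //; apply: (lt_le_trans zy).
    by rewrite lef_pV2 ?posrE ?ltr0n// ler_nat leq_addr.
  move=> j /=; apply: le_trans hzy.
  have -> : tnth t j - h y 0 j = (h z - h y) 0 j by rewrite hz !mxE.
  by rewrite [leRHS]/Num.norm /= mx_normrE; exact: (le_bigmax _ _ (0, j)).
(* There are at most [(2 K)^m] cubes of measure [(2 M' / K)^n] each; since [K^n >= K^(m+1)], the
   total is at most [C / K]. *)
pose C : R := 2 ^+ m * (2 * M') ^+ n.
have UC k : (lebesgue_tuple R n (U k) <= (C / (K k)%:R)%:E)%E.
  apply: le_trans (measure_bigsetU_le _ _ _) _.
    by move=> a; exact: measurable_closed_cube.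
  rewrite (eq_bigr (fun=> ((2 * (M' / (K k)%:R)) ^+ n)%:E)); last first.
    by move=> a _; apply: lebesgue_tuple_closed_cube; rewrite divr_ge0// ltW.
  rewrite sumEFin lee_fin sumr_const card_ffun !card_ord -[leLHS]mulr_natl.
  have -> : C / (K k)%:R = (2 * (K k)%:R) ^+ m * ((2 * M') ^+ n / (K k)%:R ^+ m.+1).
    have Km : (K k)%:R ^+ m != 0 :> R by rewrite expf_neq0// gt_eqF.
    rewrite /C [(2 * (K k)%:R) ^+ m]exprMn exprS; move: Km (K0 k).
    move: (K k)%:R (_ ^+ m) ((K k)%:R ^+ m) (_ ^+ n) => x v w u w0 x0; field.
    by rewrite w0 gt_eqF.
  rewrite natrX mulrA exprMn; apply: ler_pM.
  - by rewrite exprn_ge0.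
  - by rewrite mulr_ge0 ?exprn_ge0 ?invr_ge0 ?mulr_ge0// ltW.
  - by apply: lerXn2r; rewrite ?nnegrE ?mulr_ge0// -natr1 mulr_natl mulr2n lerD2l ler1n.
  - rewrite exprVn ler_wpM2l ?exprn_ge0 ?mulr_ge0 ?(ltW M'0)//.
    rewrite lef_pV2 ?posrE ?exprn_gt0//.
    by apply: ler_weXn2l => //; rewrite ler1n.
exists (\bigcap_k U k); split; first exact: bigcapT_measurable.
  apply/eqP; rewrite eq_le measure_ge0 andbT; apply/lee_addgt0Pr => e e0; rewrite add0e.
  pose k := Num.truncn (C / e).
  apply: (@le_trans _ _ (lebesgue_tuple R n (U k))).
    by apply: le_measure; rewrite ?inE//; [exact: bigcapT_measurable|exact: bigcap_inf].
  apply: le_trans (UC k) _; rewrite lee_fin ler_pdivrMr// -ler_pdivrMl// mulrC.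
  by rewrite (le_trans (ltW (truncnS_gt _)))// ler_nat /K addSn ltnS leq_addl.
by move=> t Yt k _; exact: YU.
Qed.

Lemma differentiable_image_negligible (E : set 'rV[R]_m) :
  E `<=` @unit_cube R m -> (forall y, E y -> differentiable h y) ->
  rV_negligible (h @` E).
Proof.
move=> E1 dh; pose Y (M : nat) := [set y | E y /\
  forall z, `|z - y| < M.+1%:R^-1 -> `|h z - h y| <= M.+1%:R * `|z - y|].
apply: (@rV_negligibleS _ _ _ (\bigcup_M (h @` Y M))).
  move=> _ [y Ey <-]; have [M HM] := differentiable_pointwise_lipschitz (dh y Ey).
  by exists M => //; exists y.
apply: rV_negligible_bigcup => M; apply: (@lipschitz_image_negligible _ M).
  by move=> y [/E1].
by move=> y z [_]; exact.
Qed.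

End lipschitz_image.

(** * The frontier of the floor *)

Section frontier.
Context (R : realType) (T : topologicalType) (n : nat) (N : metric_atlas R T n).
Hypotheses (n_gt0 : (0 < n)%N) (N_riemannian : is_riemannian_manifold N).

(** A cell is parametrized in a single chart [i]; the part seen in another chart [l] is a
    differentiable image, through the transition map, of part of the cube of dimension [n - 1]. *)
Lemma smooth_cell_null (K : set T) : smooth_cell N K -> null_set N K.
Proof.
move=> [i [s [s_smooth s_img ->]]] l.
pose E := [set y | @unit_cube R n.-1 y /\ chart_dom N l (param N i (s y))].
apply: (@rV_negligibleS _ _ _ (((coord N l \o param N i) \o s) @` E)).
  by move=> _ [_ [[_ [y y1 <-] <-] ly] <-]; exists y.
apply: differentiable_image_negligible; first by rewrite ltn_predL.
  by move=> y [].
move=> y [y1 ly]; apply: differentiable_comp.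
  by have [+ _] := s_smooth 1%N; apply.
have [_ [_ [_ [/(_ i l 1%N)[+ _] _]]]] := N_riemannian; apply.
by apply/(chart_imgP N_riemannian); split => //; apply: s_img; exists y.
Qed.

Lemma frontier_null (F : set T) : piecewise_smooth_floor N F ->
  null_set N (closure F `\` interior F).
Proof.
move=> [_ F_cells] l; apply: rV_negligible_locally => x.
move=> /(chart_imgP N_riemannian)[lx /F_cells[V [k [K [pV K_cell VK _]]]]].
exists (param N l @^-1` V); first exact: (param_continuous N_riemannian lx).
(* The finite family of cells is padded with empty sets into a sequence. *)
pose B (m : nat) := if insub m is Some j then chart_img N l (K j) else set0.
apply: (@rV_negligibleS _ _ _ (\bigcup_m B m)).
  move=> y [/(chart_imgP N_riemannian)[ly yF] yV].
  have [j _ Kjy] : (\bigcup_j K j) (param N l y) by exact: VK.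
  exists (val j) => //; rewrite /B valK; apply/(chart_imgP N_riemannian); split => //.
apply: rV_negligible_bigcup => m; rewrite /B; case: insubP => [j _ _|_].
  exact: smooth_cell_null.
by rewrite /rV_negligible preimage_set0; exact: negligible_set0.
Qed.

(** For a constant, the exceptional points are those of [F] outside its interior, all on the
    frontier. *)
Lemma ae_differentiable_cst (F : set T) (h : R) :
  piecewise_smooth_floor N F -> ae_differentiable N F (fun=> h).
Proof.
move=> /frontier_null F0 l; apply: rV_negligibleS (F0 l) => _ [q [[Fq nq] lq] <-].
exists q => //; split => //; split; first exact: subset_closure.
move=> iq; apply: nq; split => // i _; exact: differentiable_cst.
Qed.

End frontier.

(** * Comparison of the volumes *)

Lemma row_of_tuple_tcons (R : realType) (n : nat) (a : R)
    (t : n.-tuple (measurableTypeR R)) :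
  row_of_tuple (tcons (a, t)) = row_mx a%:M (row_of_tuple t) :> 'rV_(1 + n).
Proof.
apply/rowP => j; rewrite [LHS]mxE; case: (splitP j) => k jk.
- have -> : j = lshift n k by exact/val_inj.
  by rewrite row_mxEl !ord1 !mxE eqxx mulr1n (_ : (@lshift 1 n ord0 : 'I_n.+1) = ord0) ?tnth0//; exact/val_inj.
- have -> : j = rshift 1 k by exact/val_inj.
  by rewrite row_mxEr mxE (_ : (@rshift 1 n k : 'I_n.+1) = lift ord0 k) ?tnthS//; exact/val_inj.
Qed.

Section warped_volumes.
Context (R : realType) (T : topologicalType) (n : nat) (N : metric_atlas R T n)
  (f : R -> R) (F : set T).
Hypotheses (N_riemannian : is_riemannian_manifold N) (f_gt0 : forall t, 0 < f t).

Let D i := chart_img N i (F `&` chart_piece N i).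

Let D_piece i x : D i x -> chart_img N i (chart_piece N i) x.
Proof. by move=> /(chart_imgP N_riemannian)[ix [_ px]]; apply/(chart_imgP N_riemannian). Qed.

Let D_floor i x : D i x -> F (param N i x).
Proof. by move=> /(chart_imgP N_riemannian)[_ []]. Qed.

Let fn_ge0 t : 0 <= f t ^+ n. Proof. by rewrite exprn_ge0// ltW. Qed.

Local Notation rho := (volume_density N).

Let density_ge0 (k : R) i x : 0 <= k -> 0 <= k * rho i x.
Proof. by move=> k0; rewrite mulr_ge0// volume_density_ge0. Qed.

Lemma rV_integral_ge0 (E : set 'rV[R]_n) (phi : 'rV[R]_n -> R) :
  (forall x, E x -> 0 <= phi x) -> (0 <= rV_integral E phi)%E.
Proof. by move=> phi0; apply: integral_ge0 => t Et; rewrite lee_fin phi0. Qed.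

Lemma rV_integralZl (E : set 'rV[R]_n) (k : R) (phi : 'rV[R]_n -> R) :
  0 <= k -> (forall x, E x -> 0 <= phi x) ->
  rV_integral E (fun x => k * phi x)%R = (k%:E * rV_integral E phi)%E.
Proof. by move=> k0 phi0; rewrite /rV_integral lower_integralZl// => t; exact: phi0. Qed.

Let floor_volume i := rV_integral (D i) (rho i).

Let floor_volume_ge0 i : (0 <= floor_volume i)%E.
Proof. by apply: rV_integral_ge0 => x _; exact: volume_density_ge0. Qed.

Lemma graph_volume_cst (h : R) : graph_volume f N F (fun=> h) =
  ((f h ^+ n)%:E * \sum_(i <oo) floor_volume i)%E.
Proof.
rewrite -nneseriesZl//; apply: eq_eseriesr => i _.
rewrite -rV_integralZl//; last by move=> x _; exact: volume_density_ge0.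
apply: eq_integral => t; rewrite inE => Dt.
by rewrite (graph_density_cst N_riemannian f_gt0)//; exact: D_piece.
Qed.

Lemma graph_volume_ge (g : T -> R) (i : nat) : ae_differentiable N F g ->
  (rV_integral (D i) (fun x => (f (g (param N i x)) ^+ n * rho i x)%R) <=
   rV_integral (D i) (fun x => Num.sqrt (\det (pullback_metric (warped_product f N)
     ((fun q => (g q, q)) \o param N i) x))))%E.
Proof.
move=> /(_ i) dg; apply: (ae_le_lower_integral dg) => [t _|t _|t Dt nt].
- exact: density_ge0.
- exact: sqrtr_ge0.
apply: (graph_density_ge N_riemannian f_gt0 (D_piece Dt)).
have /(chart_imgP N_riemannian)[it [Ft _]] := Dt.
have [idom coordt] := chart_imgT_param N_riemannian it.
apply: contrapT => ndt; apply: nt; exists (param N i (row_of_tuple t)) => //.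
by split => //; split => // -[_ /(_ i idom)]; rewrite coordt.
Qed.

Variable P : R -> R.
Hypothesis P_int : forall y, 0 <= y ->
  (\int[@lebesgue_measure R]_(a in `[0%R, y]) (f a ^+ n)%:E = (P y)%:E)%E.

Let P_ge0 y : 0 <= y -> 0 <= P y.
Proof.
by move=> y0; rewrite -lee_fin -P_int// integral_ge0// => a _; rewrite lee_fin.
Qed.

Let room_volume_piece (g : T -> R) (i : nat) : \bar R :=
  rV_integral (chart_img (warped_product f N) i
    (room F g `&` chart_piece (warped_product f N) i))
    (fun x => Num.sqrt (\det (metric (warped_product f N) i x))).

Let room_density_tcons i a t :
  Num.sqrt (\det (metric (warped_product f N) i (row_of_tuple (tcons (a, t))))) =
  f a ^+ n * rho i (row_of_tuple t).
Proof.
rewrite [in LHS]row_of_tuple_tcons (room_density N f_gt0).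
by rewrite row_mxKl row_mxKr mxE eqxx mulr1n.
Qed.

Let room_tcons (g : T -> R) i a t :
  (@row_of_tuple R n.+1 @^-1` chart_img (warped_product f N) i
    (room F g `&` chart_piece (warped_product f N) i)) (tcons (a, t)) <->
  (@row_of_tuple R n @^-1` D i) t /\ 0 <= a <= g (param N i (row_of_tuple t)).
Proof.
rewrite /preimage /= row_of_tuple_tcons.
apply: iff_trans (chart_img_room N_riemannian _ _ _ _ _) _.
by rewrite row_mxKl row_mxKr mxE eqxx mulr1n.
Qed.

Lemma room_volume_le (g : T -> R) (i : nat) : (forall q, F q -> 0 <= g q) ->
  (room_volume_piece g i <=
   rV_integral (D i) (fun x => (P (g (param N i x)) * rho i x)%R))%E.
Proof.
move=> g0; apply: (subgraph_integral_le fn_ge0 P_int _ (room_density_tcons i)).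
- by move=> t; exact: volume_density_ge0.
- exact: room_tcons.
- by move=> t /D_floor/g0.
Qed.

Lemma room_volume_cst_ge (h : R) (i : nat) : continuous f -> 0 <= h ->
  ((P h)%:E * floor_volume i <= room_volume_piece (fun=> h) i)%E.
Proof.
move=> fc h0.
apply: (subgraph_integral_cst_ge _ fn_ge0 P_int _ (room_density_tcons i) h0).
- by move=> t; exact: (continuous_comp (fc t) (@exprn_continuous _ n _)).
- by move=> t; exact: volume_density_ge0.
- exact: room_tcons.
Qed.

Let measurable_floor_density (k : R) i :
  measurable_fun (@row_of_tuple R n @^-1` chart_img N i setT)
    (fun t => k * rho i (row_of_tuple t)).
Proof.
apply: measurable_funM => //.
apply: (@measurable_comp_row_of_tuple _ _ _ (rho i)) => [|x ix].
  exact: (chart_imgT_open N_riemannian).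
exact: (volume_density_continuous N_riemannian ix).
Qed.

(** The pointwise inequality [Pc] at [g], multiplied by the density and integrated over one piece.
    Of the two summands on the right, [P h] times the density is the measurable one that
    subadditivity asks for. *)
Lemma tangent_integral_le (g : T -> R) (h c : R) (i : nat) :
  0 <= h -> 0 <= c -> (forall q, F q -> 0 <= g q) ->
  (forall t, 0 <= t -> P t + c * f h ^+ n <= P h + c * f t ^+ n) ->
  (rV_integral (D i) (fun x => (P (g (param N i x)) * rho i x)%R) +
     (c * f h ^+ n)%R%:E * floor_volume i <=
   c%:E * rV_integral (D i) (fun x => (f (g (param N i x)) ^+ n * rho i x)%R) +
     (P h)%:E * floor_volume i)%E.
Proof.
move=> h0 c0 g0 Pc; have rho0 x : D i x -> 0 <= rho i x.
  by move=> _; exact: volume_density_ge0.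
have Pg x : D i x -> 0 <= P (g (param N i x)) by move=> /D_floor/g0/P_ge0.
rewrite -!rV_integralZl ?mulr_ge0 ?P_ge0//; last by move=> x _; exact: density_ge0.
apply: le_trans (lower_integral_superadditive _ _ _) _.
- by move=> t Dt; rewrite density_ge0// Pg.
- by move=> t Dt; rewrite density_ge0// mulr_ge0.
have mO := measurable_row_of_tuple_open (@chart_imgT_open _ _ _ _ N_riemannian i).
apply: le_trans (lower_integral_subadditive _ mO _ (@measurable_floor_density (P h) i) _ _).
- apply: le_lower_integral => t Dt; rewrite ?lee_fin.
  + by rewrite addr_ge0// density_ge0 ?Pg// mulr_ge0.
  + by rewrite addr_ge0 ?density_ge0 ?P_ge0// mulr_ge0 ?density_ge0.
  + move=> _; split => //; rewrite mulrA -!mulrDl ler_wpM2r ?rho0//.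
    by rewrite [leRHS]addrC Pc// g0//; exact: D_floor.
- by move=> t; exact: chart_img_subT.
- by move=> t _; rewrite mulr_ge0 ?density_ge0.
- by move=> t _; rewrite density_ge0// P_ge0.
Qed.

Lemma room_volume_le_cst (g : T -> R) (h c A : R) : continuous f ->
  0 <= h -> 0 <= c -> ceiling f N F A g -> graph_volume f N F (fun=> h) = A%:E ->
  (forall t, 0 <= t -> P t + c * f h ^+ n <= P h + c * f t ^+ n) ->
  (room_volume f N F g <= room_volume f N F (fun=> h))%E.
Proof.
move=> fc h0 c0 [g0 dg gA] hA Pc.
have piece_ge0 g' i : (0 <= room_volume_piece g' i)%E.
  by apply: integral_ge0 => t _; rewrite lee_fin sqrtr_ge0.
(* The finite term [c * A] is added to both sides, then read on the left as the area at height [h]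
   and on the right as the area of the graph of [g]. *)
rewrite -(@leeD2rE _ (c%:E * A%:E)%E)//.
rewrite -{1}hA graph_volume_cst muleA -EFinM -gA.
rewrite -!nneseriesZl//; last first.
  by move=> i _; apply: rV_integral_ge0 => x _; exact: sqrtr_ge0.
rewrite -!nneseriesD//; first last.
- by move=> i _ _; rewrite mule_ge0// lee_fin mulr_ge0.
- by move=> i _ _; exact: piece_ge0.
- by move=> i _ _; rewrite mule_ge0// rV_integral_ge0// => x _; exact: sqrtr_ge0.
- by move=> i _ _; exact: piece_ge0.
apply: lee_nneseries => i _; first by rewrite adde_ge0 ?piece_ge0// mule_ge0// lee_fin mulr_ge0.
apply: le_trans (leeD2r _ (room_volume_le i g0)) _.
apply: le_trans (tangent_integral_le i h0 c0 g0 Pc) _.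
rewrite [leRHS]addeC; apply: leeD; last exact: room_volume_cst_ge.
by apply: lee_wpmul2l; [rewrite lee_fin|exact: graph_volume_ge].
Qed.

End warped_volumes.

Theorem mainTheorem3 (R : realType) (T : topologicalType) (n : nat)
    (N : metric_atlas R T n) (f : R -> R) (F : set T)
    (n_gt0 : (0 < n)%N)
    (N_riemannian : is_riemannian_manifold N)
    (f_gt0 : forall t, 0 < f t)
    (f_smooth : forall (k : nat) (t : R), derivable (derive1n k f) t 1)
    (f_logconvex : convex_function [set: R] (fun t => ln (f t)))
    (f0 : f 0 = 1)
    (f_unbounded : ~ has_ubound (f @` [set t | 0 <= t]))
    (W_complete : is_complete (warped_product f N))
    (F_smooth : piecewise_smooth_floor N F)
    (F_volume : (0 < graph_volume f N F (fun=> 0%R) < +oo)%E) :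
  (forall h : R, 0 <= h ->
     graph_volume f N F (fun=> h) =
     (graph_volume f N F (fun=> 0%R) * (f h ^+ n)%:E)%E) /\
  exists A0 : R, forall A : R, A0 <= A ->
    let solutions := [set h : R | 0 <= h /\ graph_volume f N F (fun=> h) = A%:E] in
    ((exists h, solutions = [set h]) \/
     (exists h1 h2, h1 <> h2 /\ solutions = [set h1; h2])) /\
    exists h, [/\ solutions h,
      (forall h', solutions h' -> h' <> h ->
         (room_volume f N F (fun=> h') < room_volume f N F (fun=> h))%E),
      ceiling f N F A (fun=> h) &
      forall g, ceiling f N F A g ->
        (room_volume f N F g <= room_volume f N F (fun=> h))%E].
Proof.
have f_der t : derivable f t 1 by exact: (f_smooth 0%N).
have f_cont : continuous f.
  by move=> t; apply/differentiable_continuous/derivable1_diffP; exact: f_der.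
have volE h : graph_volume f N F (fun=> h) =
    (graph_volume f N F (fun=> 0%R) * (f h ^+ n)%:E)%E.
  rewrite (graph_volume_cst F N_riemannian f_gt0 h).
  by rewrite (graph_volume_cst F N_riemannian f_gt0 0) f0 expr1n mul1e muleC.
split; first by move=> h _; exact: volE.
have [v v0 vE] : exists2 v : R, 0 < v & graph_volume f N F (fun=> 0%R) = v%:E.
  case/andP: F_volume; case: (graph_volume _ _ _ _) => // v; rewrite lte_fin => v0 _.
  by exists v.
(* Any threshold above the floor volume [v] would do: [A > v] forces [f h > 1], where uniqueness of
   the height and the positivity of [c] both hold. *)
exists (v + 1) => A vA.
have A_gt0 : 0 < A by lra.
have Av : 1 < A / v by rewrite ltr_pdivlMr//; lra.
(* The value that [f] must take: [v * f h ^+ n = A] amounts to [f h = a], as [f] is positive. *)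
pose a := (A / v) `^ n%:R^-1.
have Av0 : 0 <= A / v by rewrite ltW// (lt_trans _ Av).
have n0 : n%:R != 0 :> R by rewrite pnatr_eq0 -lt0n.
have aE : a ^+ n = A / v by rewrite -powR_mulrn ?powR_ge0// -powRrM mulVf// powRr1.
have a1 : 1 < a.
  rewrite ltNge; apply/negP => a1; move: Av; rewrite -aE ltNge.
  by rewrite exprn_ile1// powR_ge0.
have [h h0 fh] := logconvex_surj f_der f0 f_unbounded a1.
have solE h' : 0 <= h' -> graph_volume f N F (fun=> h') = A%:E <-> f h' = a.
  move=> h'0; rewrite volE vE -EFinM; split=> [[vf]|->]; last first.
    by rewrite aE mulrCA divff ?mulr1// gt_eqF.
  apply/eqP; rewrite -(@eqrXn2 _ n)// ?powR_ge0 ?(ltW (f_gt0 _))// aE -vf.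
  by rewrite mulrC mulKf // gt_eqF.
have fh1 : 1 < f h by rewrite fh.
have hA : graph_volume f N F (fun=> h) = A%:E by apply/solE; [exact: ltW|].
have sol_uniq h' : 0 <= h' /\ graph_volume f N F (fun=> h') = A%:E -> h' = h.
  move=> [h'0 /(solE _ h'0) fh']; apply/esym.
  by apply: (logconvex_inj f_logconvex f0 (ltW h0) h'0 fh1); rewrite fh fh'.
split.
  left; exists h; apply/seteqP; split => [h' /= /sol_uniq//|_ ->]; split => //.
  exact: ltW.
have fn_cont : continuous (fun t => f t ^+ n).
  by move=> t; exact: (continuous_comp (f_cont t) (@exprn_continuous _ n _)).
have [P P_der P_int] := continuous_primitive_ge0 fn_cont.
have [c c0 Pc] := logconvex_primitive_le f_gt0 f_der f_logconvex f0 n_gt0 P_der h0 fh1.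
exists h; split.
- by split => //; exact: ltW.
- by move=> h' /sol_uniq.
- split => //; first by move=> q _; exact: ltW.
  exact: (ae_differentiable_cst n_gt0 N_riemannian).
- move=> g gA.
  exact: (room_volume_le_cst N_riemannian f_gt0 P_int f_cont (ltW h0) c0 gA hA Pc).
Qed.
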